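(* For $i=1,2$, let $n_i$ be a positive integer and let $M_i\subset S^{n_i}(1/\sqrt2)$ be a minimal R-space. Then $M_1\times M_2\subset S^{n_1+n_2+1}(1)$ is a biharmonic submanifold of $S^{n_1+n_2+1}(1)$. Moreover, when $\dim M_1\neq\dim M_2$, $M_1\times M_2\subset S^{n_1+n_2+1}(1)$ is proper biharmonic.
   Context: $S^{n}(r)$ denotes the sphere of radius $r$ centered at the origin in $\mathbb{R}^{n+1}$ with its induced metric. The product $M_1\times M_2\subset S^{n_1}(1/\sqrt2)\times S^{n_2}(1/\sqrt2)\subset\mathbb{R}^{n_1+1}\times\mathbb{R}^{n_2+1}=\mathbb{R}^{n_1+n_2+2}$ is regarded as a submanifold of $S^{n_1+n_2+1}(1)$. R-spaces. Let $G$ be a compact connected semisimple Lie group, $\sigma$ an involutive automorphism of $G$, and $K$ a subgroup with $\mathrm{Fix}(\sigma,G)_0\subset K\subset\mathrm{Fix}(\sigma,G)$ ($\mathrm{Fix}(\sigma,G)$ the fixed point subgroup, subscript $0$ the identity component). Let $\mathfrak{g}$ be the Lie algebra of $G$, $\mathfrak{k}$ that of $K$, $\mathfrak{m}=\{X\in\mathfrak{g}\mid\sigma(X)=-X\}$ (with $\sigma$ also denoting the induced involution of $\mathfrak{g}$), and let $\langle\cdot,\cdot\rangle$ be an $\mathrm{Ad}(K)$-invariant inner product on $\mathfrak{g}$ for which $\mathfrak{g}=\mathfrak{k}\oplus\mathfrak{m}$ is orthogonal. $K$ acts isometrically on $\mathfrak{m}$ by $\mathrm{Ad}$ (the linear isotropy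 representation of the symmetric space $G/K$). An orbit $\mathrm{Ad}(K)H$ of a vector $H\in\mathfrak{m}$ with $\langle H,H\rangle=r^2>0$, viewed as a submanifold of the sphere of radius $r$ in $\mathfrak{m}$, is called an R-space; it is a minimal R-space if it is a minimal submanifold of that sphere. ''$M_i\subset S^{n_i}(1/\sqrt2)$ is a minimal R-space'' means that $M_i$ is such a minimal orbit with $r=1/\sqrt2$, for some $(G_i,\sigma_i,K_i)$ with $\dim\mathfrak{m}_i=n_i+1$ and $\mathfrak{m}_i$ identified isometrically with $\mathbb{R}^{n_i+1}$. Biharmonicity. For a smooth map $\varphi:(M,g)\to(N,h)$ of Riemannian manifolds, with $\overline{\nabla}$ the induced connection on $\varphi^{-1}TN$, the second fundamental form is $B_\varphi(X,Y)=\overline{\nabla}_X(d\varphi(Y))-d\varphi(\nabla_XY)$ and the tension field is $\tau_\varphi=\sum_iB_\varphi(e_i,e_i)$ ($\{e_i\}$ a local orthonormal frame). $\varphi$ is harmonic if $\tau_\varphi=0$, and biharmonic if $J(\tau_\varphi)=0$, where $J(V)=-\sum_i\{\overline{\nabla}_{e_i}\overline{\nabla}_{e_i}V-\overline{\nabla}_{\nabla_{e_i}e_i}V\}-\sum_iR^h(V,d\varphi(e_i))d\varphi(e_i)$ with $R^h(X,Y)Z=\nabla_X\nabla_YZ-\nabla_Y\nabla_XZ-\nabla_{[X,Y]}Z$. A submanifold (with induced metric) is harmonic (equivalently minimal), respectively biharmonic, if its inclusion map is. A biharmonic submanifold is proper if it is not harmonic. *)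

(* Defs.v *)
From HB Require Import structures.
From mathcomp Require Import all_boot all_order all_algebra.
From mathcomp Require Import all_classical all_reals all_analysis.

Set Implicit Arguments.
Unset Strict Implicit.
Unset Printing Implicit Defensive.
Import Order.TTheory GRing.Theory Num.Theory.
Import numFieldNormedType.Exports.
Local Open Scope classical_set_scope.
Local Open Scope ring_scope.

Section Smooth.
Context {R : realType}.

Definition partial {n : nat} {W : normedModType R} (i : 'I_n)
    (f : 'rV[R]_n -> W) : 'rV[R]_n -> W :=
  fun x => 'D_(delta_mx 0 i : 'rV[R]_n) f x.

Fixpoint iter_partial {n : nat} {W : normedModType R} (s : seq 'I_n)
    (f : 'rV[R]_n -> W) : 'rV[R]_n -> W :=
  if s is i :: s' then partial i (iter_partial s' f) else f.

(* C^oo on U, which is open in all uses: all iterated partial derivatives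
   exist and are continuous. *)
Definition smooth_on {n : nat} {W : normedModType R} (U : set 'rV[R]_n)
    (f : 'rV[R]_n -> W) : Prop :=
  forall (s : seq 'I_n) (x : 'rV[R]_n), U x ->
    {for x, continuous (iter_partial s f)} /\
    (forall i, derivable (iter_partial s f) x (delta_mx 0 i : 'rV[R]_n)).

Definition dotp {n : nat} (u v : 'rV[R]_n) : R := \sum_i u 0 i * v 0 i.

End Smooth.

(* A coordinate chart of a subset M of T: its domain is M `&` cnbhd with cnbhd
   open in T, its image is the open set ccod, and cbwd is its inverse (a local
   parametrization of M). Values outside these sets are irrelevant. *)
Record chart (R : realType) (T : topologicalType) (n : nat) := Chart {
  cnbhd : set T;
  ccod : set 'rV[R]_n;
  cfwd : T -> 'rV[R]_n;
  cbwd : 'rV[R]_n -> T }.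

Section Charts.
Context {R : realType}.

Definition is_chart {T : topologicalType} {n : nat} (M : set T)
    (c : chart R T n) : Prop :=
  [/\ open (cnbhd c),
      open (ccod c),
      forall p, M p -> cnbhd c p -> ccod c (cfwd c p) /\ cbwd c (cfwd c p) = p
    & forall x, ccod c x ->
        [/\ M (cbwd c x), cnbhd c (cbwd c x) & cfwd c (cbwd c x) = x]].

Definition smooth_map {T T' : topologicalType} {n n' : nat}
    (A : set (chart R T n)) (A' : set (chart R T' n')) (F : T -> T') : Prop :=
  continuous F /\
  forall c c', A c -> A' c' ->
    smooth_on [set x | ccod c x /\ cnbhd c' (F (cbwd c x))]
      (cfwd c' \o F \o cbwd c).

Definition smooth_atlas {T : topologicalType} {n : nat}
    (A : set (chart R T n)) : Prop :=
  [/\ forall c, A c -> [/\ is_chart [set: T] c,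
        {within cnbhd c, continuous (cfwd c)}
      & {within ccod c, continuous (cbwd c)}],
      forall p, exists2 c, A c & cnbhd c p
    & smooth_map A A id].

Definition prod_chart {T T' : topologicalType} {n n' : nat}
    (c : chart R T n) (c' : chart R T' n') : chart R (T * T')%type (n + n') :=
  Chart (cnbhd c `*` cnbhd c')
    [set x | ccod c (lsubmx x) /\ ccod c' (rsubmx x)]
    (fun p => row_mx (cfwd c p.1) (cfwd c' p.2))
    (fun x => (cbwd c (lsubmx x), cbwd c' (rsubmx x))).

Definition prod_atlas {T T' : topologicalType} {n n' : nat}
    (A : set (chart R T n)) (A' : set (chart R T' n')) :
    set (chart R (T * T')%type (n + n')) :=
  [set e | exists c c', [/\ A c, A' c' & e = prod_chart c c']].

Definition smooth_fun {T : topologicalType} {n : nat} (A : set (chart R T n))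
    (f : T -> R) : Prop :=
  forall c, A c -> smooth_on (ccod c) (f \o cbwd c).

(* The chart maps are diffeomorphisms between M `&` cnbhd and ccod; a map on a
   subset of R^d is smooth when it is the restriction of a smooth map on an open
   subset of R^d. *)
Definition embedded_chart {d m : nat} (M : set 'rV[R]_d)
    (c : chart R 'rV[R]_d m) : Prop :=
  [/\ is_chart M c, smooth_on (cnbhd c) (cfwd c)
    & smooth_on (ccod c) (cbwd c)].

Definition embedded_submanifold {d : nat} (m : nat) (M : set 'rV[R]_d) : Prop :=
  forall p, M p -> exists2 c : chart R 'rV[R]_d m, embedded_chart M c & cnbhd c p.

Definition induced_metric {d m : nat} (c : chart R 'rV[R]_d m)
    (x : 'rV[R]_m) : 'M[R]_m :=
  \matrix_(i, j) dotp (partial i (cbwd c) x) (partial j (cbwd c) x).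

Definition sphere {d : nat} (r : R) : set 'rV[R]_d := [set x | dotp x x = r ^+ 2].

End Charts.

(* A Riemannian metric on a coordinate domain is its Gram matrix as a function
   of the point; tangent vectors are given by their components. *)
Section LeviCivita.
Context {R : realType} {n : nat}.
Variable g : 'rV[R]_n -> 'M[R]_n.
Implicit Types (X Y Z : 'rV[R]_n -> 'rV[R]_n) (x u v w : 'rV[R]_n).

Definition christoffel x (k i j : 'I_n) : R :=
  2^-1 * \sum_l invmx (g x) k l *
    (partial i (fun y => g y j l) x + partial j (fun y => g y i l) x
     - partial l (fun y => g y i j) x).

Definition christoffel_form x u v : 'rV[R]_n :=
  \row_k \sum_i \sum_j christoffel x k i j * u 0 i * v 0 j.

Definition nabla X Y : 'rV[R]_n -> 'rV[R]_n :=
  fun x => 'D_(X x) Y x + christoffel_form x (X x) (Y x).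

Definition lie_bracket X Y : 'rV[R]_n -> 'rV[R]_n :=
  fun x => 'D_(X x) Y x - 'D_(Y x) X x.

Definition curvature_fields X Y Z : 'rV[R]_n -> 'rV[R]_n :=
  nabla X (nabla Y Z) - nabla Y (nabla X Z) - nabla (lie_bracket X Y) Z.

(* The curvature tensor at x. By tensoriality the extensions of the tangent
   vectors u, v, w to vector fields are immaterial; here they have constant
   components. *)
Definition curvature x u v w : 'rV[R]_n :=
  curvature_fields (fun=> u) (fun=> v) (fun=> w) x.

Definition orthonormal_frame (W : set 'rV[R]_n)
    (e : 'I_n -> 'rV[R]_n -> 'rV[R]_n) : Prop :=
  (forall i, smooth_on W (e i)) /\
  (forall x, W x -> forall i j, (e i x *m g x *m (e j x)^T) 0 0 = (i == j)%:R).

End LeviCivita.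

Section BiharmonicMaps.
Context {R : realType} {m n : nat}.
Variables (g : 'rV[R]_m -> 'M[R]_m) (h : 'rV[R]_n -> 'M[R]_n).
Variable phi : 'rV[R]_m -> 'rV[R]_n.
Implicit Types (X Y : 'rV[R]_m -> 'rV[R]_m) (V : 'rV[R]_m -> 'rV[R]_n).
Implicit Types e : 'I_m -> 'rV[R]_m -> 'rV[R]_m.

Definition dmap X : 'rV[R]_m -> 'rV[R]_n := fun x => 'D_(X x) phi x.

Definition nabla_pullback X V : 'rV[R]_m -> 'rV[R]_n :=
  fun x => 'D_(X x) V x + christoffel_form h (phi x) (dmap X x) (V x).

Definition second_fundamental_form X Y : 'rV[R]_m -> 'rV[R]_n :=
  nabla_pullback X (dmap Y) - dmap (nabla g X Y).

Definition tension_field e : 'rV[R]_m -> 'rV[R]_n :=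
  \sum_i second_fundamental_form (e i) (e i).

Definition jacobi_operator e V : 'rV[R]_m -> 'rV[R]_n := fun x =>
  - (\sum_i (nabla_pullback (e i) (nabla_pullback (e i) V) x
             - nabla_pullback (nabla g (e i) (e i)) V x))
  - \sum_i curvature h (phi x) (V x) (dmap (e i) x) (dmap (e i) x).

End BiharmonicMaps.

Section Submanifolds.
Context {R : realType} {d : nat}.
Implicit Types (m n : nat) (M N : set 'rV[R]_d).

(* P g h phi W e holds for every coordinate expression phi of the inclusion of
   M in N, with g and h the induced metrics in the charts used, and every
   local orthonormal frame e of M defined on the open set W. *)
Definition inclusion_satisfies m n M N
    (P : ('rV[R]_m -> 'M[R]_m) -> ('rV[R]_n -> 'M[R]_n) ->
         ('rV[R]_m -> 'rV[R]_n) -> ('I_m -> 'rV[R]_m -> 'rV[R]_m) ->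
         'rV[R]_m -> Prop) : Prop :=
  forall (c : chart R 'rV[R]_d m) (c' : chart R 'rV[R]_d n),
    embedded_chart M c -> embedded_chart N c' ->
  forall (W : set 'rV[R]_m) (e : 'I_m -> 'rV[R]_m -> 'rV[R]_m),
    open W -> W `<=` [set x | ccod c x /\ cnbhd c' (cbwd c x)] ->
    orthonormal_frame (induced_metric c) W e ->
  forall x, W x ->
    P (induced_metric c) (induced_metric c') (cfwd c' \o cbwd c) e x.

Definition harmonic_inclusion m n M N : Prop :=
  @inclusion_satisfies m n M N (fun g h phi e x =>
    tension_field g h phi e x = 0).

Definition biharmonic_inclusion m n M N : Prop :=
  @inclusion_satisfies m n M N (fun g h phi e x =>
    jacobi_operator g h phi e (tension_field g h phi e) x = 0).

Definition submanifold_of m n M N : Prop :=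
  [/\ embedded_submanifold m M, embedded_submanifold n N & M `<=` N].

Definition minimal_submanifold m n M N : Prop :=
  submanifold_of m n M N /\ harmonic_inclusion m n M N.

Definition biharmonic_submanifold m n M N : Prop :=
  submanifold_of m n M N /\ biharmonic_inclusion m n M N.

Definition proper_biharmonic_submanifold m n M N : Prop :=
  biharmonic_submanifold m n M N /\ ~ harmonic_inclusion m n M N.

End Submanifolds.

Definition product_submanifold {R : realType} {d1 d2 : nat}
    (M1 : set 'rV[R]_d1) (M2 : set 'rV[R]_d2) : set 'rV[R]_(d1 + d2) :=
  [set row_mx p.1 p.2 | p in M1 `*` M2].

#[short(type="topologicalGroupBase")]
HB.structure Definition TopologicalGroupBase :=
  {G of Topological G & Group G}.

Record lieGroup (R : realType) := LieGroup {
  lg_sort :> topologicalGroupBase;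
  lg_dim : nat;
  lg_atlas : set (chart R lg_sort lg_dim);
  lg_hausdorff : hausdorff_space lg_sort;
  lg_second_countable : @second_countable lg_sort;
  lg_smooth_atlas : smooth_atlas lg_atlas;
  lg_smooth_mul : smooth_map (prod_atlas lg_atlas lg_atlas) lg_atlas
    (fun p : lg_sort * lg_sort => (p.1 * p.2)%g);
  lg_smooth_inv : smooth_map lg_atlas lg_atlas
    (fun x : lg_sort => (x^-1)%g) }.
Arguments lg_atlas {R} l.

Section LieGroups.
Context {R : realType}.
Variable G : lieGroup R.

Definition lg_smooth (f : G -> R) : Prop := smooth_fun (lg_atlas G) f.

(* Operators on smooth functions; they are required below to vanish on
   functions that are not smooth, so that equality of operators is equality of
   their restrictions to smooth functions. *)
Definition operator : Type := (G -> R) -> (G -> R).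

(* The Lie algebra of G: the left-invariant vector fields, as derivations of
   the algebra of smooth functions. *)
Definition lie_algebra : set operator := [set X |
  [/\ forall f, ~ lg_smooth f -> X f = cst 0,
      forall f, lg_smooth f -> lg_smooth (X f),
      forall (a : R) f1 f2, lg_smooth f1 -> lg_smooth f2 ->
        X (fun x => a * f1 x + f2 x) = (fun x => a * X f1 x + X f2 x),
      forall f1 f2, lg_smooth f1 -> lg_smooth f2 ->
        X (fun x => f1 x * f2 x) = (fun x => X f1 x * f2 x + f1 x * X f2 x)
    & forall (a : G) f, lg_smooth f ->
        X (fun x => f (a * x)%g) = (fun x => X f (a * x)%g)]].

Definition op_lin (a : R) (X Y : operator) : operator :=
  fun f x => a * X f x + Y f x.

Definition op_bracket (X Y : operator) : operator :=
  fun f x => X (Y f) x - Y (X f) x.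

Definition op0 : operator := fun _ _ => 0.

(* Push-forward of a vector field by a diffeomorphism F with inverse F'. *)
Definition pushforward (F F' : G -> G) (X : operator) : operator :=
  fun f => X (f \o F) \o F'.

Definition Ad (k : G) (X : operator) : operator :=
  pushforward (fun x => k * x * k^-1)%g (fun x => k^-1 * x * k)%g X.

Definition abelian_ideal (a : set operator) : Prop :=
  [/\ a `<=` lie_algebra,
      a op0,
      forall (s : R) X Y, a X -> a Y -> a (op_lin s X Y),
      forall X Y, lie_algebra X -> a Y -> a (op_bracket X Y)
    & forall X Y, a X -> a Y -> op_bracket X Y = op0].

(* A Lie algebra is semisimple when its only abelian ideal is 0 (Bourbaki). *)
Definition semisimple : Prop :=
  forall a, abelian_ideal a -> a = [set op0].

Definition involutive_automorphism (sigma : G -> G) : Prop :=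
  [/\ forall x y, sigma (x * y)%g = (sigma x * sigma y)%g,
      smooth_map (lg_atlas G) (lg_atlas G) sigma
    & involutive sigma].

Definition Fix (sigma : G -> G) : set G := [set x | sigma x = x].

Definition subgroup (K : set G) : Prop :=
  [/\ K 1%g, forall x y, K x -> K y -> K (x * y)%g
    & forall x, K x -> K (x^-1)%g].

(* The Lie algebra of a subgroup: the generators of the one-parameter
   subgroups contained in it. *)
Definition lie_subalgebra_of (K : set G) : set operator := [set X |
  lie_algebra X /\
  exists gamma : R -> G,
    [/\ forall s t, gamma (s + t) = (gamma s * gamma t)%g,
        forall t, K (gamma t)
      & forall f, lg_smooth f -> forall t : R,
          is_derive t 1 (f \o gamma) (X f (gamma t))]].

Definition minus_eigenspace (sigma : G -> G) : set operator :=
  [set X | lie_algebra X /\ pushforward sigma sigma X = op_lin (-1) X op0].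

Definition inner_product (ip : operator -> operator -> R) : Prop :=
  [/\ forall X Y, lie_algebra X -> lie_algebra Y -> ip X Y = ip Y X,
      forall (a : R) X Y Z, lie_algebra X -> lie_algebra Y -> lie_algebra Z ->
        ip (op_lin a X Y) Z = a * ip X Z + ip Y Z
    & forall X, lie_algebra X -> X <> op0 -> 0 < ip X X].

Record symmetric_data (sigma : G -> G) (K : set G)
    (ip : operator -> operator -> R) : Prop := SymmetricData {
  sd_compact : compact [set: G];
  sd_connected : connected [set: G];
  sd_semisimple : semisimple;
  sd_involution : involutive_automorphism sigma;
  sd_subgroup : subgroup K;
  sd_lower : connected_component (Fix sigma) 1%g `<=` K;
  sd_upper : K `<=` Fix sigma;
  sd_ip : inner_product ip;
  sd_ip_Ad : forall k X Y, K k -> lie_algebra X -> lie_algebra Y ->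
    ip (Ad k X) (Ad k Y) = ip X Y;
  sd_decomp : forall X, lie_algebra X -> exists Y Z,
    [/\ lie_subalgebra_of K Y, minus_eigenspace sigma Z & X = op_lin 1 Y Z];
  sd_orthogonal : forall X Y, lie_subalgebra_of K X ->
    minus_eigenspace sigma Y -> ip X Y = 0 }.

(* A linear isometry of R^d onto m; in particular dim m = d. *)
Definition isometric_identification (sigma : G -> G)
    (ip : operator -> operator -> R) {d : nat} (iota : 'rV[R]_d -> operator) :
    Prop :=
  [/\ forall (a : R) u v, iota (a *: u + v) = op_lin a (iota u) (iota v),
      range iota = minus_eigenspace sigma
    & forall u v, ip (iota u) (iota v) = dotp u v].

End LieGroups.

Definition R_space {R : realType} {n : nat} (r : R) (M : set 'rV[R]_n.+1) :
    Prop :=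
  exists (G : lieGroup R) (sigma : G -> G) (K : set G)
      (ip : operator G -> operator G -> R) (iota : 'rV[R]_n.+1 -> operator G)
      (H : operator G),
    [/\ symmetric_data sigma K ip,
        isometric_identification sigma ip iota,
        minus_eigenspace sigma H,
        0 < r /\ ip H H = r ^+ 2
      & M = [set u | exists2 k, K k & iota u = Ad k H]].

Definition minimal_R_space {R : realType} {n : nat} (m : nat) (r : R)
    (M : set 'rV[R]_n.+1) : Prop :=
  R_space r M /\ minimal_submanifold m n M (sphere r).

(* Main.v *)
Require Import Defs.
From HB Require Import structures.
From mathcomp Require Import all_boot all_order all_algebra.
From mathcomp Require Import all_classical all_reals all_analysis.
From mathcomp Require Import ring.

(** Let [f] be the position vector of the product [M], with components [f1] and
    [f2] of squared length 1/2, and let [eta = (f1, - f2)], the unit normal of the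
    product of the two spheres inside the unit sphere. Everything is computed on
    vector fields transported to the ambient Euclidean space.

    Write [II] for the second fundamental form in Euclidean space
    ([normal_hessian]). In a sphere of radius [r] the inclusion of an
    m-dimensional submanifold has tension [tr II + (m / r^2) f] ([push_tension]),
    so minimality of [Mi] says that [tr IIi = - 2 mi fi] ([minimal_trace]). The
    form [II] of a product is the pair of the forms of its factors and its trace
    can be taken in any frame, so on [M] the trace is [(- 2 m1 f1, - 2 m2 f2)]
    ([product_chart_traces]); adding [(m1 + m2) f] gives the tension
    [(m2 - m1) eta] ([clifford_tension]). It vanishes at a point only if [m1 = m2].

    For biharmonicity, put [eta = A f] with [A] the reflection in the first
    factor. The derivative of [eta] along [v] is [A v], it has no component along
    [f] because [eta] is normal to [M], and differentiating once more shows that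
    the rough Laplacian of [eta] is [A (tr II) + tr (A | TM) f], which equals
    [(- 2 m1 f1, 2 m2 f2) + (m1 - m2) f = - (m1 + m2) eta]. The unit sphere has
    curvature 1, so the curvature term of the Jacobi operator contributes
    [(m1 + m2) eta] and the two cancel ([jacobi_operator_eq0],
    [clifford_biharmonic]). The [Mi] are orbits, hence nonempty, so that there is a
    point at which the tension is nonzero when [m1] and [m2] differ.

    Around this computation some calculus is needed. Smoothness is given by
    iterated partial derivatives, whereas the chain rule needs differentiability
    ([C1_differentiable]) and the Gauss formula and the curvature of the sphere
    need the symmetry of second derivatives ([schwarz]). Minimality is a statement
    about orthonormal frames, which are produced by the Gram-Schmidt process
    ([exists_orthonormal_frame]); the unit sphere gets its charts from
    stereographic projection ([embedded_sphere]). *)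

Set Implicit Arguments.
Unset Strict Implicit.
Unset Printing Implicit Defensive.
Import Order.TTheory GRing.Theory Num.Theory.
Import numFieldNormedType.Exports.
Local Open Scope ring_scope.

(** * Differentiability from continuous partial derivatives *)

Section Differentiation.
Local Open Scope classical_set_scope.
Local Open Scope ring_scope.
Context {R : realType}.

Lemma near_open {T : topologicalType} (U : set T) (x : T) :
  open U -> U x -> \forall y \near x, U y.
Proof. by move=> oU Ux; apply: open_nbhs_nbhs. Qed.

(** The epsilon form of differentiability, for candidates [df] that are found by
    estimates. *)
Lemma differentiable_of_bound {V W : normedModType R} (f : V -> W)
    (df : {linear V -> W}) x : continuous df ->
  (forall e : R, 0 < e -> \forall h \near 0, `|f (h + x) - (f x + df h)| <= e * `|h|) ->
  differentiable f x /\ 'd f x = df :> (V -> W).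
Proof.
move=> cdf H.
have E : f \o shift x = cst (f x) + df +o_ 0 id by apply/eqaddoP => e e0; exact: H.
have D := diff_unique cdf E.
by split => //; apply/diff_locallyP; rewrite D.
Qed.

Lemma eq_near_differentiable {V W : normedModType R} (f g : V -> W) x :
  (\near x, f x = g x) -> differentiable f x -> differentiable g x.
Proof.
move=> fg df; apply: (@differentiable_of_bound _ _ g ('d f x) x _ _).1.
  exact: diff_continuous.
move=> e e0; have [_ /eqaddoP/(_ e e0)] := (diff_locallyP _ _).1 df.
apply: filter_app.
have : \forall h \near 0, f (h + x) = g (h + x).
  by move: (fg); rewrite (near_shift 0) /= subr0.
rewrite -(nbhs_singleton fg).
by apply: filter_app; near=> h => <-.
Unshelve. all: by end_near. Qed.

Lemma eq_on_differentiable {V W : normedModType R} (U : set V) (f g : V -> W) x :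
  open U -> U x -> (forall y, U y -> f y = g y) ->
  differentiable f x -> differentiable g x.
Proof.
move=> oU Ux fg; apply: eq_near_differentiable.
by apply: filterS (near_open oU Ux) => y; exact: fg.
Qed.

Lemma eq_on_derive {V W : normedModType R} (U : set V) (f g : V -> W) x v :
  open U -> U x -> (forall y, U y -> f y = g y) -> 'D_v f x = 'D_v g x.
Proof.
move=> oU Ux fg; apply: near_eq_derive.
by apply: filterS (near_open oU Ux) => y; exact: fg.
Qed.


Lemma is_derive_line {V : normedModType R} (f : V -> R) y v (t : R) :
  derivable f (t *: v + y) v ->
  is_derive t 1 (fun s => f (s *: v + y)) ('D_v f (t *: v + y)).
Proof.
have E : (fun h : R => h^-1 *: (((fun s => f (s *: v + y)) \o shift t) (h *: 1)
      - f (t *: v + y))) =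
    (fun h => h^-1 *: ((f \o shift (t *: v + y)) (h *: v) - f (t *: v + y))).
  by apply/funext => h /=; rewrite scaler1 scalerDl addrA.
by move=> df; apply: DeriveDef; rewrite /derivable /derive E.
Qed.

(** The parameter [t] is only known up to sign so that increments of both signs
    are treated alike. *)
Lemma mean_value_line {V : normedModType R} (f : V -> R) y v (a : R) :
  (forall t : R, `|t| <= `|a| -> derivable f (t *: v + y) v) ->
  exists2 t : R, `|t| <= `|a| & f (a *: v + y) - f y = a * 'D_v f (t *: v + y).
Proof.
move=> df; pose g s := f (s *: v + y).
have dg (t : R) : `|t| <= `|a| -> is_derive t 1 g ('D_v f (t *: v + y)).
  by move=> /df; exact: is_derive_line.
have cg (p q : R) : (forall t, t \in `[p, q] -> `|t| <= `|a|) ->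
    {within `[p, q], continuous g}.
  by move=> H; apply: derivable_within_continuous => t /H /dg [].
have g0 : g 0 = f y by rewrite /g scale0r add0r.
have [a0|a0] := leP 0 a.
  have H (t : R) : t \in `[0, a] -> `|t| <= `|a|.
    by rewrite in_itv /= => /andP[t0 ta]; rewrite !ger0_norm.
  have [t tI E] := @MVT_segment R g (fun t => 'D_v f (t *: v + y)) 0 a a0
    (fun t tI => dg t (H t (subset_itv_oo_cc tI))) (cg _ _ H).
  by exists t; [exact: H | rewrite -/(g a) -g0 E subr0 mulrC].
have H (t : R) : t \in `[a, 0] -> `|t| <= `|a|.
  by rewrite in_itv /= => /andP[t0 ta]; rewrite !ler0_norm ?lerN2 // ltW.
have [t tI E] := @MVT_segment R g (fun t => 'D_v f (t *: v + y)) a 0 (ltW a0)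
  (fun t tI => dg t (H t (subset_itv_oo_cc tI))) (cg _ _ H).
exists t; first exact: H.
by rewrite -/(g a) -g0 -opprB E sub0r mulrN opprK mulrC.
Qed.

Lemma ler_mx_norm {m n : nat} (A : 'M[R]_(m, n)) i j : `|A i j| <= `|A|.
Proof. by rewrite [leRHS]/Num.Def.normr/= mx_normrE; apply: (le_bigmax _ _ (i, j)). Qed.

Lemma mx_norm_le {m n : nat} (A : 'M[R]_(m, n)) (b : R) : 0 <= b ->
  (forall i j, `|A i j| <= b) -> `|A| <= b.
Proof.
move=> b0 Ab; rewrite [leLHS]/Num.Def.normr/= mx_normrE.
by apply: bigmax_le => // -[i j] _; exact: Ab.
Qed.


(** An increment is walked one coordinate at a time. On each leg the mean value
    theorem gives a partial derivative at a point near [x], which by continuity is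
    almost the partial derivative at [x]. *)
Lemma C1_differentiable_scalar {n : nat} (U : set 'rV[R]_n) (f : 'rV[R]_n -> R)
    (x : 'rV[R]_n) : open U -> U x ->
  (forall i y, U y -> derivable f y (delta_mx 0 i : 'rV[R]_n)) ->
  (forall i, {for x, continuous (partial i f)}) -> differentiable f x.
Proof.
move=> oU Ux df cf; pose D (h : 'rV[R]_n) : R := \sum_i h 0 i * partial i f x.
have linD : linear D.
  move=> a u v; rewrite /D scaler_sumr -big_split; apply: eq_bigr => i _ /=.
  by rewrite !mxE mulrDl -mulrA.
pose DM := GRing.isLinear.Build _ _ _ _ _ linD.
pose DL : {linear 'rV[R]_n -> R} := HB.pack D DM.
have cD : continuous DL.
  rewrite -[DL : _ -> _]/D => y; apply: differentiable_continuous.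
  have -> : D = \sum_i (fun h : 'rV[R]_n => h 0 i * partial i f x).
    by apply/funext => h; rewrite fct_sumE.
  apply: differentiable_sum => i.
  apply: differentiableM; last exact: differentiable_cst.
  exact: differentiable_coord.
apply: (@differentiable_of_bound _ _ f DL x cD _).1 => e e0.
(* There are [n] legs; dividing by [n.+1] also covers [n = 0]. *)
pose e' := e / n.+1%:R; have e'0 : 0 < e' by rewrite divr_gt0 ?ltr0Sn.
have : \forall y \near x, U y /\ forall i, `|partial i f x - partial i f y| <= e'.
  near=> y; split; first by near: y; exact: (near_open oU Ux).
  near: y; apply: filter_forall => i.
  by have /cvgrPdist_le/(_ e' e'0) := cf i.
move=> /nbhs_ballP[d /= d0 Hd].
have {}Hd y : `|y - x| < d ->
    U y /\ forall i, `|partial i f x - partial i f y| <= e'.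
  by move=> yx; apply: Hd; rewrite -ball_normE /= distrC.
apply: filterS (@nbhs0_lt _ 'rV[R]_n d d0) => h hd.
(* [p k] has moved the first [k] coordinates. *)
pose p (k : nat) : 'rV[R]_n := x + \row_j (if (j < k)%N then h 0 j else 0).
have step (k : 'I_n) :
    `|f (p k.+1) - f (p k) - h 0 k * partial k f x| <= e' * `|h|.
  have pS : p k.+1 = h 0 k *: delta_mx 0 k + p k.
    rewrite /p addrCA; congr (_ + _); apply/rowP => j; rewrite !mxE /= ltnS leq_eqVlt.
    have [->|jk] := eqVneq j k; first by rewrite eqxx ltnn /= mulr1 addr0.
    by rewrite (_ : (j == k :> nat) = false) /= ?mulr0 ?add0r //; exact/negbTE.
  have near_p (t : R) : `|t| <= `|h 0 k| -> `|t *: delta_mx 0 k + p k - x| < d.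
    move=> th; apply: le_lt_trans hd; apply: mx_norm_le => // i j.
    rewrite -addrA /p [x + _]addrC addrK (ord1 i) !mxE /=.
    have [->|jk] := eqVneq j k.
      by rewrite ltnn /= mulr1 addr0 (le_trans th) // ler_mx_norm.
    rewrite mulr0 add0r; case: ifP => _; last by rewrite normr0.
    exact: ler_mx_norm.
  rewrite pS.
  have [t th ->] := @mean_value_line _ f (p k) (delta_mx 0 k) (h 0 k)
    (fun t th => df k _ (Hd _ (near_p t th)).1).
  rewrite -mulrBr normrM mulrC ler_pM //; last exact: ler_mx_norm.
  by rewrite distrC; apply: (Hd _ (near_p t th)).2.
have p0 : p 0%N = x by apply/rowP => j; rewrite !mxE addr0.
have pn : p n = h + x.
  by rewrite addrC; apply/rowP => j; rewrite !mxE ltn_ord.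
have -> : f (h + x) - (f x + DL h) =
    \sum_(k < n) (f (p k.+1) - f (p k) - h 0 k * partial k f x).
  rewrite sumrB -(big_mkord xpredT (fun k => f (p k.+1) - f (p k))).
  by rewrite telescope_sumr // p0 pn opprD addrA.
apply: le_trans (ler_norm_sum _ _ _) _.
apply: le_trans (ler_sum _ (fun k _ => step k)) _.
rewrite sumr_const card_ord -mulr_natl mulrA ler_wpM2r //.
rewrite /e' mulrCA -[leRHS]mulr1 ler_wpM2l ?(ltW e0) //.
by rewrite ler_pdivrMr ?ltr0Sn // mul1r ler_nat.
Unshelve. all: by end_near. Qed.

End Differentiation.

(** * Symmetry of second derivatives *)

Section Schwarz.
Local Open Scope classical_set_scope.
Local Open Scope ring_scope.
Context {R : realType}.

Lemma is_derive_translate {V W : normedModType R} (f : V -> W) (w y v : V) :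
  derivable f (w + y) v ->
  is_derive y v (fun z => f (w + z)) ('D_v f (w + y)).
Proof.
have E : (fun h : R => h^-1 *: (((fun z => f (w + z)) \o shift y) (h *: v)
      - f (w + y))) =
    (fun h => h^-1 *: ((f \o shift (w + y)) (h *: v) - f (w + y))).
  by apply/funext => h /=; rewrite addrCA.
by move=> df; apply: DeriveDef; rewrite /derivable /derive E.
Qed.

Let distr_common (a b c c' e : R) : c = c' ->
  `|a - c| <= e / 2 -> `|b - c'| <= e / 2 -> `|b - a| <= e.
Proof.
move=> <- ac bc; rewrite [e]splitr; apply: le_trans (ler_distD c _ _) _.
by apply: lerD; rewrite // distrC.
Qed.

(** The mean value theorem in direction [u], then in direction [v]. The left-hand
    side is symmetric in [u] and [v] and the right-hand side is not, which is what
    makes mixed derivatives commute. *)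
Lemma second_difference {V : normedModType R} (U : set V) (f : V -> R)
    (x u v : V) (s : R) :
  (forall p q : R, `|p| <= `|s| -> `|q| <= `|s| -> U (p *: u + (q *: v + x))) ->
  (forall y, U y -> derivable f y u) ->
  (forall y, U y -> derivable ('D_u f) y v) ->
  exists p q : R, [/\ `|p| <= `|s|, `|q| <= `|s| &
    f (s *: u + (s *: v + x)) - f (s *: u + x) - (f (s *: v + x) - f x)
    = s * (s * 'D_v ('D_u f) (p *: u + (q *: v + x)))].
Proof.
move=> HU df ddf; pose p y := f (s *: v + y) - f y.
have Ux (a : R) : `|a| <= `|s| -> U (a *: u + x).
  by move=> /(HU _ 0); rewrite normr0 scale0r add0r; exact.
have dp (a : R) : `|a| <= `|s| -> is_derive (a *: u + x) u p
    ('D_u f (s *: v + (a *: u + x)) - 'D_u f (a *: u + x)).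
  move=> sa; apply: is_deriveB; last by apply/derivableP/df/Ux.
  by apply: is_derive_translate; apply: df; rewrite addrCA; exact: HU.
have [t st E] := mean_value_line (fun a sa => @ex_derive _ _ _ _ _ _ _ (dp a sa)).
have Uq (q : R) : `|q| <= `|s| -> U (q *: v + (t *: u + x)).
  by move=> sq; rewrite addrCA; exact: HU.
have [q sq Eq] := @mean_value_line _ _ ('D_u f) (t *: u + x) v s
  (fun q sq => ddf _ (Uq q sq)).
exists t, q; split => //.
rewrite [t *: u + (q *: v + x)]addrCA -Eq -(@derive_val _ _ _ _ _ _ _ (dp t st)) -E.
by rewrite /p [in LHS]addrCA.
Qed.

(** Second differences with steps tending to 0 approach both mixed derivatives. *)
Lemma schwarz_scalar {V : normedModType R} (U : set V) (f : V -> R) (x u v : V) :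
  open U -> U x ->
  (forall y w, U y -> derivable f y w) ->
  (forall y w z, U y -> derivable ('D_w f) y z) ->
  (forall w z, {for x, continuous ('D_z ('D_w f))}) ->
  'D_u ('D_v f) x = 'D_v ('D_u f) x.
Proof.
move=> oU Ux df ddf cf.
apply/eqP; rewrite -subr_eq0 -normr_le0; apply/ler_addgt0Pl => e e0; rewrite addr0.
have e20 : 0 < e / 2 by rewrite divr_gt0.
have /cvgrPdist_le/(_ _ e20)/nbhs_ballP[d1 /= d10 H1] := cf u v.
have /cvgrPdist_le/(_ _ e20)/nbhs_ballP[d2 /= d20 H2] := cf v u.
have /nbhs_ballP[d3 /= d30 H3] := near_open oU Ux.
pose d := Num.min d1 (Num.min d2 d3).
have d0 : 0 < d by rewrite !lt_min d10 d20.
have Hd y : ball x d y -> [/\ U y, `|'D_v ('D_u f) x - 'D_v ('D_u f) y| <= e / 2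
    & `|'D_u ('D_v f) x - 'D_u ('D_v f) y| <= e / 2].
  move=> xy; split; [apply: H3|apply: H1|apply: H2];
    by apply: le_ball xy; rewrite !ge_min lexx ?orbT.
pose s := d / (2 * (`|u| + `|v| + 1)).
have uv0 : 0 < `|u| + `|v| + 1 by rewrite ltr_wpDl.
have s0 : 0 < s by rewrite divr_gt0 // mulr_gt0.
have HB (p q : R) : `|p| <= `|s| -> `|q| <= `|s| ->
    [/\ U (p *: u + (q *: v + x)),
       `|'D_v ('D_u f) x - 'D_v ('D_u f) (p *: u + (q *: v + x))| <= e / 2
    & `|'D_u ('D_v f) x - 'D_u ('D_v f) (p *: u + (q *: v + x))| <= e / 2].
  move=> sp sq; apply: Hd; rewrite -ball_normE /= distrC addrA addrK.
  apply: le_lt_trans (ler_normD _ _) _; rewrite !normrZ.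
  apply: (@le_lt_trans _ _ (s * (`|u| + `|v| + 1))); last first.
    by rewrite /s invfM mulrA mulfVK ?gt_eqF // ltr_pdivrMr // ltr_pMr // ltr1n.
  rewrite (gtr0_norm s0) in sp sq.
  by rewrite mulrDr mulrDr mulr1 ler_wpDr ?(ltW s0) // lerD // ler_wpM2r.
have HU p q sp sq := let: And3 h _ _ := HB p q sp sq in h.
have [p1 [q1 [sp1 sq1 E1]]] :=
  @second_difference _ U f x u v s HU (fun y => df y u) (fun y => ddf y u v).
have HU' (p q : R) : `|p| <= `|s| -> `|q| <= `|s| -> U (p *: v + (q *: u + x)).
  by move=> sp sq; rewrite addrCA; exact: HU.
have [p2 [q2 [sp2 sq2 E2]]] := @second_difference _ U f x v u s HU' (fun y => df y v)
  (fun y => ddf y v u).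
have [_ {}H1 _] := HB _ _ sp1 sq1; have [_ _ {}H2] := HB _ _ sq2 sp2.
have E : 'D_v ('D_u f) (p1 *: u + (q1 *: v + x)) =
         'D_u ('D_v f) (q2 *: u + (p2 *: v + x)).
  have sn0 : s != 0 by rewrite gt_eqF.
  rewrite (addrCA (q2 *: u)); apply: (mulfI sn0); apply: (mulfI sn0).
  apply: etrans (esym E1) (etrans _ E2); rewrite (addrCA (s *: v)).
  by rewrite opprB opprB addrACA [RHS]addrACA; congr (_ + _); rewrite addrC.
exact: distr_common E H1 H2.
Qed.
End Schwarz.

(** * Calculus of smooth maps between coordinate spaces *)

Section SmoothCalculus.
Local Open Scope classical_set_scope.
Local Open Scope ring_scope.
Context {R : realType}.
Implicit Types (V W : normedModType R).

Lemma derive_linear {V W} (f : V -> W) x (a : R) u v : differentiable f x ->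
  'D_(a *: u + v) f x = a *: 'D_u f x + 'D_v f x.
Proof. by move=> df; rewrite !deriveE // linearP. Qed.

Lemma derive_vecD {V W} (f : V -> W) x u v : differentiable f x ->
  'D_(u + v) f x = 'D_u f x + 'D_v f x.
Proof. by move=> df; rewrite !deriveE // linearD. Qed.

Lemma derive_vecB {V W} (f : V -> W) x u v : differentiable f x ->
  'D_(u - v) f x = 'D_u f x - 'D_v f x.
Proof. by move=> df; rewrite !deriveE // linearB. Qed.

Lemma derive_vecZ {V W} (f : V -> W) x (a : R) u : differentiable f x ->
  'D_(a *: u) f x = a *: 'D_u f x.
Proof. by move=> df; rewrite !deriveE // linearZ. Qed.

Lemma derive_vec_sum {V W} (f : V -> W) x (I : finType) (F : I -> V) :
  differentiable f x -> 'D_(\sum_i F i) f x = \sum_i 'D_(F i) f x.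
Proof.
move=> df; rewrite !deriveE // linear_sum.
by apply: eq_bigr => i _; rewrite deriveE.
Qed.

Lemma derive_partials {n} {W} (f : 'rV[R]_n -> W) x v : differentiable f x ->
  'D_v f x = \sum_i v 0 i *: partial i f x.
Proof.
move=> df; rewrite {1}(row_sum_delta v) derive_vec_sum //.
by apply: eq_bigr => i _; rewrite derive_vecZ.
Qed.

Lemma derive_comp {U V W : normedModType R} (g : U -> V) (f : V -> W) x v :
  differentiable g x -> differentiable f (g x) ->
  'D_v (fun y => f (g y)) x = 'D_('D_v g x) f (g x).
Proof.
move=> dg df; rewrite deriveE; last exact: differentiable_comp.
by rewrite (diff_comp dg df) /= !deriveE.
Qed.

Lemma derive_post_linear {V W W' : normedModType R} (L : {linear W -> W'})
    (f : V -> W) x v : continuous L -> differentiable f x ->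
  'D_v (fun y => L (f y)) x = L ('D_v f x).
Proof.
move=> cL df; have dL y : differentiable L y by exact: linear_differentiable.
by rewrite derive_comp // deriveE // (diff_lin _ cL).
Qed.

(** Scaling is a continuous bilinear map composed with the pair [(a, f)]. *)
Lemma is_diff_scale {V W} (a : V -> R) (f : V -> W) x :
  differentiable a x -> differentiable f x ->
  differentiable (fun y => a y *: f y) x /\
  forall v, 'D_v (fun y => a y *: f y) x = a x *: 'D_v f x + 'D_v a x *: f x.
Proof.
move=> da df.
have bil : bilinear_for (GRing.Scale.Law.clone _ _ *:%R _)
    (GRing.Scale.Law.clone _ _ *:%R _) (fun (k : R) (w : W) => k *: w).
  by split=> [w|k] c y z /=; rewrite ?scalerDl ?scalerDr ?scalerA // mulrC.
pose BM := bilinear_isBilinear.Build R R W W _ _ _ bil.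
pose B : {bilinear R -> W -> W} := HB.pack (fun (k : R) (w : W) => k *: w) BM.
have cB : continuous (fun p : R * W => B p.1 p.2).
  by move=> p; apply: scale_continuous.
pose P y := (a y, f y).
have dP : differentiable P x by exact: differentiable_pair.
have dB := differentiable_bilin (P x) cB.
have E : (fun y => a y *: f y) = (fun p => B p.1 p.2) \o P by [].
have D : differentiable (fun y => a y *: f y) x by rewrite E; exact: differentiable_comp.
split=> // v; rewrite !deriveE // E (diff_comp dP dB) (diff_bilin _ cB) /P.
by rewrite (diff_pair da df).
Qed.

Lemma differentiable_scale {V W} (a : V -> R) (f : V -> W) x :
  differentiable a x -> differentiable f x ->
  differentiable (fun y => a y *: f y) x.
Proof. by move=> da df; have [] := is_diff_scale da df. Qed.

Lemma derive_scale {V W} (a : V -> R) (f : V -> W) x v :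
  differentiable a x -> differentiable f x ->
  'D_v (fun y => a y *: f y) x = a x *: 'D_v f x + 'D_v a x *: f x.
Proof. by move=> da df; have [_] := is_diff_scale da df; apply. Qed.

Lemma differentiable_add {V W} (f g : V -> W) x : differentiable f x ->
  differentiable g x -> differentiable (fun y => f y + g y) x.
Proof. exact: differentiableD. Qed.

Lemma derive_add {V W} (f g : V -> W) x v : differentiable f x ->
  differentiable g x -> 'D_v (fun y => f y + g y) x = 'D_v f x + 'D_v g x.
Proof. by move=> df dg; apply: deriveD; exact: diff_derivable. Qed.

Lemma sum_diff {V W} (I : finType) (F : I -> V -> W) x :
  (forall i, differentiable (F i) x) ->
  differentiable (fun y => \sum_i F i y) x /\
  forall v, 'D_v (fun y => \sum_i F i y) x = \sum_i 'D_v (F i) x.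
Proof.
move=> dF.
suff [D E] : differentiable (fun y => \sum_(i <- index_enum I) F i y) x /\
  forall v, 'D_v (fun y => \sum_(i <- index_enum I) F i y) x =
    \sum_(i <- index_enum I) 'D_v (F i) x by split.
elim: (index_enum I) => [|i s [IHd IHe]].
  have -> : (fun y => \sum_(i <- [::]) F i y) = cst 0.
    by apply/funext => y; rewrite big_nil.
  split; first exact: differentiable_cst.
  by move=> v; rewrite derive_cst big_nil.
have -> : (fun y => \sum_(j <- i :: s) F j y) =
    (fun y => F i y + \sum_(j <- s) F j y).
  by apply/funext => y; rewrite big_cons.
split; first exact: differentiable_add.
by move=> v; rewrite derive_add // big_cons IHe.
Qed.

Lemma differentiable_rV {V} {d} (f : V -> 'rV[R]_d) x :
  (forall j, differentiable (fun y => f y 0 j) x) -> differentiable f x.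
Proof.
move=> df; have -> : f = (fun y => \sum_j f y 0 j *: (delta_mx 0 j : 'rV[R]_d)).
  by apply/funext => y; exact: row_sum_delta.
by apply: (sum_diff _).1 => j; exact: differentiable_scale.
Qed.

Lemma derive_coord {V} {d} (f : V -> 'rV[R]_d) x v j : derivable f x v ->
  'D_v (fun y => f y 0 j) x = ('D_v f x) 0 j.
Proof. by move=> df; rewrite derive_mx // mxE. Qed.

Lemma derive_entry {V} {d} (f : V -> 'rV[R]_d) x v j : differentiable f x ->
  'D_v (fun y => f y 0 j) x = ('D_v f x) 0 j.
Proof. by move=> df; apply: derive_coord; exact: diff_derivable. Qed.

(** The vector-valued case, one coordinate at a time. *)
Lemma C1_differentiable {n d : nat} (U : set 'rV[R]_n) (f : 'rV[R]_n -> 'rV[R]_d)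
    (x : 'rV[R]_n) : open U -> U x ->
  (forall i y, U y -> derivable f y (delta_mx 0 i : 'rV[R]_n)) ->
  (forall i y, U y -> {for y, continuous (partial i f)}) -> differentiable f x.
Proof.
move=> oU Ux df cf; apply: differentiable_rV => j.
apply: (C1_differentiable_scalar oU Ux) => [i y Uy|i].
  by have /derivable_mxP := df i y Uy; apply.
have E y : U y -> (partial i f y) 0 j = partial i (fun y => f y 0 j) y.
  by move=> Uy; rewrite /partial derive_coord //; exact: df.
rewrite /continuous_at /prop_for -E //.
have c : (fun y => (partial i f y) 0 j) @ x --> (partial i f x) 0 j.
  apply: (@continuous_comp _ _ _ (partial i f) (fun M : 'rV[R]_d => M 0 j)).
    exact: cf.
  exact: coord_continuous.
apply: cvg_trans _ c; apply: (@near_eq_cvg _ _ (nbhs x) _).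
near=> y; apply: E; near: y; exact: (near_open oU Ux).
Unshelve. all: by end_near. Qed.

(** Differentiability in every direction, and not only along the axes, is part of
    each level, so that the chain rule is available at all levels. Level 0 is empty:
    continuity at one level follows from differentiability at the next, and the
    class [Cinf] is the usual one. *)
Fixpoint Ck {n} {W} (k : nat) (U : set 'rV[R]_n) (f : 'rV[R]_n -> W) : Prop :=
  if k is k'.+1 then (forall x, U x -> differentiable f x) /\
                     (forall v, Ck k' U ('D_v f))
  else True.

Definition Cinf {n} {W} (U : set 'rV[R]_n) (f : 'rV[R]_n -> W) : Prop :=
  forall k, Ck k U f.

Lemma Ck_eq {n} {W} k (U : set 'rV[R]_n) (f g : 'rV[R]_n -> W) : open U ->
  (forall x, U x -> f x = g x) -> Ck k U f -> Ck k U g.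
Proof.
move=> oU; elim: k f g => //= k IH f g fg [df Df]; split.
  by move=> x Ux; apply: eq_on_differentiable oU Ux fg (df x Ux).
by move=> v; apply: IH (Df v) => x Ux; exact: eq_on_derive oU Ux fg.
Qed.

Lemma CkS {n} {W} k (U : set 'rV[R]_n) (f : 'rV[R]_n -> W) : Ck k.+1 U f -> Ck k U f.
Proof.
elim: k f => // k IH f [df Df]; split=> // v; apply: IH; exact: Df.
Qed.

Lemma Ck_subset {n} {W} k (U V : set 'rV[R]_n) (f : 'rV[R]_n -> W) :
  V `<=` U -> Ck k U f -> Ck k V f.
Proof.
move=> VU; elim: k f => //= k IH f [df Df]; split=> [x /VU|v]; first exact: df.
exact: IH.
Qed.

Lemma Cinf_differentiable {n} {W} (U : set 'rV[R]_n) (f : 'rV[R]_n -> W) x :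
  Cinf U f -> U x -> differentiable f x.
Proof. by move=> /(_ 1%N)[df _]; exact: df. Qed.

Lemma Cinf_derive {n} {W} (U : set 'rV[R]_n) (f : 'rV[R]_n -> W) v :
  Cinf U f -> Cinf U ('D_v f).
Proof. by move=> sf k; have [_] := sf k.+1; apply. Qed.

Lemma Ck_cst {n} {W} k (U : set 'rV[R]_n) (w : W) : Ck k U (fun=> w).
Proof.
elim: k w => // k IH w; split=> [x _|v]; first exact: differentiable_cst.
have -> : 'D_v (fun=> w) = (fun=> 0) :> ('rV[R]_n -> W) by apply/funext => x; rewrite derive_cst.
exact: IH.
Qed.

Lemma Ck_id {n} k (U : set 'rV[R]_n) : open U -> Ck k U (fun y : 'rV[R]_n => y).
Proof.
move=> oU; case: k => // k; split=> [x _|v]; first exact: ex_diff.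
apply: (@Ck_eq _ _ k U (fun=> v)) => //; last exact: Ck_cst.
by move=> x _; rewrite derive_id.
Qed.

Lemma Ck_sum {n} {W} k (U : set 'rV[R]_n) (I : finType) (F : I -> 'rV[R]_n -> W) :
  open U -> (forall i, Ck k U (F i)) -> Ck k U (fun y => \sum_i F i y).
Proof.
move=> oU; elim: k F => // k IH F sF; split=> [x Ux|v].
  by apply: (sum_diff _).1 => i; apply: (sF i).1.
apply: (@Ck_eq _ _ _ _ (fun x => \sum_i 'D_v (F i) x)) => //.
  by move=> x Ux; rewrite (sum_diff _).2 // => i; apply: (sF i).1.
by apply: IH => i; exact: (sF i).2.
Qed.

Lemma Ck_add {n} {W} k (U : set 'rV[R]_n) (f g : 'rV[R]_n -> W) :
  open U -> Ck k U f -> Ck k U g -> Ck k U (fun y => f y + g y).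
Proof.
move=> oU sf sg; pose F (b : bool) := if b then f else g.
apply: (@Ck_eq _ _ _ _ (fun y => \sum_b F b y)) => //.
  by move=> x _; rewrite big_bool.
by apply: Ck_sum => // -[].
Qed.

Lemma Ck_scale {n} {W} k (U : set 'rV[R]_n) (a : 'rV[R]_n -> R) (f : 'rV[R]_n -> W) :
  open U -> Ck k U a -> Ck k U f -> Ck k U (fun y => a y *: f y).
Proof.
move=> oU; elim: k a f => // k IH a f sa sf; split=> [x Ux|v].
  by apply: differentiable_scale; [exact: sa.1|exact: sf.1].
apply: (@Ck_eq _ _ _ _ (fun x => a x *: 'D_v f x + 'D_v a x *: f x)) => //.
  by move=> x Ux; rewrite derive_scale //; [exact: sa.1|exact: sf.1].
apply: Ck_add => //; apply: IH.
- exact: CkS sa.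
- exact: sf.2.
- exact: sa.2.
- exact: CkS sf.
Qed.

Lemma Ck_linear {n} {W W' : normedModType R} k (U : set 'rV[R]_n)
    (L : {linear W -> W'}) (f : 'rV[R]_n -> W) : continuous L ->
  open U -> Ck k U f -> Ck k U (fun y => L (f y)).
Proof.
move=> cL oU; elim: k f => // k IH f sf; split=> [x Ux|v].
  by apply: differentiable_comp; [exact: sf.1|exact: linear_differentiable].
apply: (@Ck_eq _ _ _ _ (fun x => L ('D_v f x))) => //.
  by move=> x Ux; rewrite derive_post_linear //; exact: sf.1.
by apply: IH; exact: sf.2.
Qed.

Lemma Ck_coord {n d} k (U : set 'rV[R]_n) (f : 'rV[R]_n -> 'rV[R]_d) j :
  open U -> Ck k U f -> Ck k U (fun y => f y 0 j).
Proof.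
move=> oU; elim: k f => // k IH f sf; split=> [x Ux|v].
  by apply: (@differentiable_comp _ _ _ _ f (fun M : 'rV[R]_d => M 0 j));
    [exact: sf.1|exact: differentiable_coord].
apply: (@Ck_eq _ _ _ _ (fun x => ('D_v f x) 0 j)) => //.
  by move=> x Ux; rewrite derive_coord //; apply: diff_derivable; exact: sf.1.
by apply: IH; exact: sf.2.
Qed.

Lemma Ck_rV {n d} k (U : set 'rV[R]_n) (f : 'rV[R]_n -> 'rV[R]_d) :
  open U -> (forall j, Ck k U (fun y => f y 0 j)) -> Ck k U f.
Proof.
move=> oU sf.
apply: (@Ck_eq _ _ _ _ (fun y => \sum_j f y 0 j *: (delta_mx 0 j : 'rV[R]_d))) => //.
  by move=> y _; rewrite -row_sum_delta.
by apply: Ck_sum => // j; apply: Ck_scale => //; exact: Ck_cst.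
Qed.

(** By the chain rule a derivative of a composite is a combination of composites
    [partial i f] after [g], whose coefficients are derivatives of [g]. *)
Lemma Ck_comp {n p} {W} k (U : set 'rV[R]_n) (V : set 'rV[R]_p)
    (g : 'rV[R]_n -> 'rV[R]_p) (f : 'rV[R]_p -> W) :
  open U -> (forall x, U x -> V (g x)) -> Ck k U g -> Ck k V f ->
  Ck k U (fun y => f (g y)).
Proof.
move=> oU UV; elim: k f => // k IH f sg sf.
have dg x : U x -> differentiable g x by exact: sg.1.
have df x : U x -> differentiable f (g x) by move=> /UV; exact: sf.1.
split=> [x Ux|v]; first by apply: differentiable_comp; [exact: dg|exact: df].
apply: (@Ck_eq _ _ _ _ (fun x => \sum_i ('D_v g x) 0 i *: partial i f (g x))) => //.
  move=> x Ux; rewrite (derive_comp v (dg x Ux) (df x Ux)).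
  by rewrite (derive_partials _ (df x Ux)).
apply: Ck_sum => // i; apply: Ck_scale => //.
  by apply: Ck_coord => //; exact: sg.2.
by apply: IH; [exact: CkS sg|exact: sf.2].
Qed.

Lemma powR_comp {V} (a : V -> R) (p : R) x : differentiable a x -> 0 < a x ->
  differentiable (fun y => a y `^ p) x /\
  forall v, 'D_v (fun y => a y `^ p) x = (p * a x `^ (p - 1)) * 'D_v a x.
Proof.
move=> da a0; have [dp ep] := @is_derive1_powR R p (a x) a0.
pose q (y : R) := y `^ p.
have dq : differentiable q (a x) by apply/derivable1_diffP.
have D : differentiable (fun y => a y `^ p) x.
  exact: (@differentiable_comp _ _ _ _ a q).
split=> // v; rewrite (@derive_comp _ _ _ a q x v da dq) (deriveE _ dq).
by rewrite (diff1E dq) derive1E ep; exact: mulrC.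
Qed.

(** Real powers are closed under differentiation up to a constant factor; the
    exponents -1 and -1/2 give inverses and normalizations. *)
Lemma Ck_powR {n} k (U : set 'rV[R]_n) (a : 'rV[R]_n -> R) (p : R) :
  open U -> (forall x, U x -> 0 < a x) -> Ck k U a -> Ck k U (fun y => a y `^ p).
Proof.
move=> oU a0; elim: k p => // k IH p sa; split=> [x Ux|v].
  by apply: (powR_comp p (sa.1 x Ux) (a0 x Ux)).1.
apply: (@Ck_eq _ _ _ _ (fun x => (p * a x `^ (p - 1)) *: 'D_v a x)) => //.
  by move=> x Ux; rewrite (powR_comp p (sa.1 x Ux) (a0 x Ux)).2.
apply: Ck_scale => //; last exact: sa.2.
by apply: (@Ck_scale _ _ _ _ (fun=> p)) => //; [exact: Ck_cst|apply: IH; exact: CkS sa].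
Qed.

Lemma Cinf_smooth_on {n} {W} (U : set 'rV[R]_n) (f : 'rV[R]_n -> W) :
  Cinf U f -> smooth_on U f.
Proof.
move=> sf s x Ux; have ss : Cinf U (iter_partial s f).
  by elim: s => //= i s; exact: Cinf_derive.
have D := Cinf_differentiable ss Ux.
by split=> [|i]; [exact: differentiable_continuous|exact: diff_derivable].
Qed.

(** All iterated partial derivatives are treated at once, since the differentiability
    of one of them uses the continuity of the next ones. *)
Lemma smooth_on_Cinf {n d} (U : set 'rV[R]_n) (f : 'rV[R]_n -> 'rV[R]_d) :
  open U -> smooth_on U f -> Cinf U f.
Proof.
move=> oU sf k; rewrite -[f]/(iter_partial [::] f); elim: k [::] => // k IH s.
have D x : U x -> differentiable (iter_partial s f) x.
  move=> Ux; apply: (C1_differentiable oU Ux) => i y Uy.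
    by have [_] := sf s y Uy; apply.
  by have [] := sf (i :: s) y Uy.
split=> // v.
apply: (@Ck_eq _ _ _ _ (fun x => \sum_i v 0 i *: partial i (iter_partial s f) x)) => //.
  by move=> x Ux; rewrite (derive_partials v (D x Ux)).
apply: Ck_sum => // i; apply: (@Ck_scale _ _ _ _ (fun=> v 0 i)) => //.
  exact: Ck_cst.
exact: (IH (i :: s)).
Qed.

Lemma schwarz {n d} (U : set 'rV[R]_n) (f : 'rV[R]_n -> 'rV[R]_d) x u v :
  open U -> U x -> Cinf U f -> 'D_u ('D_v f) x = 'D_v ('D_u f) x.
Proof.
move=> oU Ux sf; apply/rowP => j.
have sj : Cinf U (fun y => f y 0 j) by move=> k; exact: Ck_coord.
have E w z : ('D_w ('D_z f) x) 0 j = 'D_w ('D_z (fun y => f y 0 j)) x.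
  rewrite -derive_coord; last first.
    by apply: diff_derivable; exact: Cinf_differentiable (Cinf_derive _ sf) Ux.
  apply: (eq_on_derive _ oU Ux) => y Uy; rewrite derive_coord //.
  by apply: diff_derivable; exact: Cinf_differentiable sf Uy.
apply: etrans (E u v) (etrans _ (esym (E v u))); apply: (@schwarz_scalar R 'rV[R]_n U (fun y => f y 0 j) x u v oU Ux).
- by move=> y w Uy; apply: diff_derivable; exact: Cinf_differentiable sj Uy.
- move=> y w z Uy; apply: diff_derivable.
  exact: Cinf_differentiable (Cinf_derive _ sj) Uy.
- move=> w z; apply: differentiable_continuous.
  exact: Cinf_differentiable (Cinf_derive _ (Cinf_derive _ sj)) Ux.
Qed.

Lemma linear_rV_continuous {d} {W} (L : {linear 'rV[R]_d -> W}) : continuous L.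
Proof.
have LE : (L : 'rV[R]_d -> W) = (fun v => \sum_j v 0 j *: L (delta_mx 0 j)).
  apply/funext => v; rewrite {1}(row_sum_delta v) linear_sum.
  by apply: eq_bigr => j _; rewrite linearZ.
move=> v; rewrite LE; apply: differentiable_continuous; apply: (sum_diff _).1 => j.
by apply: differentiable_scale; [exact: differentiable_coord|exact: differentiable_cst].
Qed.

End SmoothCalculus.

(** * Euclidean inner product and derivatives along vector fields *)

Section EuclideanProduct.
Local Open Scope classical_set_scope.
Local Open Scope ring_scope.
Context {R : realType}.

Lemma dotpC {d} (u v : 'rV[R]_d) : dotp u v = dotp v u.
Proof. by apply: eq_bigr => i _; rewrite mulrC. Qed.

Lemma dotpPl {d} a (u v w : 'rV[R]_d) :
  dotp (a *: u + v) w = a * dotp u w + dotp v w.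
Proof.
rewrite /dotp mulr_sumr -big_split; apply: eq_bigr => i _ /=.
by rewrite !mxE mulrDl mulrA.
Qed.

Lemma dotpDl {d} (u v w : 'rV[R]_d) : dotp (u + v) w = dotp u w + dotp v w.
Proof. by rewrite -[u]scale1r dotpPl mul1r scale1r. Qed.

Lemma dotp0l {d} (w : 'rV[R]_d) : dotp 0 w = 0.
Proof. by rewrite /dotp big1 // => i _; rewrite mxE mul0r. Qed.

Lemma dotpZl {d} a (u w : 'rV[R]_d) : dotp (a *: u) w = a * dotp u w.
Proof. by rewrite -[a *: u]addr0 dotpPl dotp0l addr0. Qed.

Lemma dotpNl {d} (u w : 'rV[R]_d) : dotp (- u) w = - dotp u w.
Proof. by rewrite -scaleN1r dotpZl mulN1r. Qed.

Lemma dotpBl {d} (u v w : 'rV[R]_d) : dotp (u - v) w = dotp u w - dotp v w.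
Proof. by rewrite dotpDl dotpNl. Qed.

Lemma dotpZr {d} a (u w : 'rV[R]_d) : dotp w (a *: u) = a * dotp w u.
Proof. by rewrite !(dotpC w) dotpZl. Qed.

Lemma dotpNr {d} (u w : 'rV[R]_d) : dotp w (- u) = - dotp w u.
Proof. by rewrite !(dotpC w) dotpNl. Qed.

Lemma dotp_suml {d} (I : finType) (F : I -> 'rV[R]_d) w :
  dotp (\sum_i F i) w = \sum_i dotp (F i) w.
Proof.
by apply: (big_morph (fun u => dotp u w)) => [u v|]; rewrite ?dotp0l ?dotpDl.
Qed.

Lemma dotp_sumr {d} (I : finType) (F : I -> 'rV[R]_d) w :
  dotp w (\sum_i F i) = \sum_i dotp w (F i).
Proof. by rewrite dotpC dotp_suml; apply: eq_bigr => i _; rewrite dotpC. Qed.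

Lemma dotp_ge0 {d} (u : 'rV[R]_d) : 0 <= dotp u u.
Proof. by apply: sumr_ge0 => i _; rewrite -expr2 sqr_ge0. Qed.

Lemma dotp_eq0 {d} (u : 'rV[R]_d) : dotp u u = 0 -> u = 0.
Proof.
move=> /eqP; rewrite psumr_eq0 => [/allP u0|i _]; last by rewrite -expr2 sqr_ge0.
apply/rowP => i; rewrite mxE; apply/eqP.
by have := u0 i (mem_index_enum i); rewrite /= mulf_eq0 orbb.
Qed.

Lemma dotp_row_mx {d1 d2} (u1 v1 : 'rV[R]_d1) (u2 v2 : 'rV[R]_d2) :
  dotp (row_mx u1 u2) (row_mx v1 v2) = dotp u1 v1 + dotp u2 v2.
Proof.
rewrite /dotp big_split_ord /=; congr (_ + _); apply: eq_bigr => i _.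
  by rewrite !row_mxEl.
by rewrite !row_mxEr.
Qed.

Lemma dotp_mulmx {d} (u v : 'rV[R]_d) : (u *m v^T) 0 0 = dotp u v.
Proof. by rewrite mxE; apply: eq_bigr => i _; rewrite mxE. Qed.

Lemma is_diff_dotp {V : normedModType R} {d} (F G : V -> 'rV[R]_d) x :
  differentiable F x -> differentiable G x ->
  differentiable (fun y => dotp (F y) (G y)) x /\
  forall v, 'D_v (fun y => dotp (F y) (G y)) x =
    dotp ('D_v F x) (G x) + dotp (F x) ('D_v G x).
Proof.
move=> dF dG.
have dc (H : V -> 'rV[R]_d) i : differentiable H x -> differentiable (fun y => H y 0 i) x.
  by move=> dH; apply: (@differentiable_comp _ _ _ _ H (fun M : 'rV[R]_d => M 0 i));
    [|exact: differentiable_coord].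
have [D E] := @sum_diff _ _ _ _ (fun i y => F y 0 i *: (G y 0 i : R)) x
  (fun i => differentiable_scale (dc F i dF) (dc G i dG)).
split=> // v; apply: etrans (E v) _; rewrite -big_split; apply: eq_bigr => i _ /=.
rewrite (derive_scale _ (dc F i dF) (dc G i dG)).
rewrite (derive_entry v i dF) (derive_entry v i dG); exact: addrC.
Qed.

Lemma derive_dotp {V : normedModType R} {d} (F G : V -> 'rV[R]_d) x v :
  differentiable F x -> differentiable G x ->
  'D_v (fun y => dotp (F y) (G y)) x = dotp ('D_v F x) (G x) + dotp (F x) ('D_v G x).
Proof. by move=> dF dG; have [_] := is_diff_dotp dF dG; apply. Qed.

Lemma Ck_dotp {n d} k (U : set 'rV[R]_n) (F G : 'rV[R]_n -> 'rV[R]_d) :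
  open U -> Ck k U F -> Ck k U G -> Ck k U (fun y => dotp (F y) (G y)).
Proof.
move=> oU sF sG; apply: (@Ck_sum _ _ _ _ _ _ (fun i y => F y 0 i * G y 0 i)) => // i.
by apply: (@Ck_scale _ _ _ _ _ (fun y => F y 0 i)) => //; exact: Ck_coord.
Qed.

(** The product rule for [f'(q y) (Y y)], where the vector and the base point both
    move with [y]. *)
Lemma derive_along {n p} {W : normedModType R} (U : set 'rV[R]_n) (V : set 'rV[R]_p)
    (q : 'rV[R]_n -> 'rV[R]_p) (Y : 'rV[R]_n -> 'rV[R]_p) (f : 'rV[R]_p -> W) x u :
  open U -> U x -> (forall y, U y -> V (q y)) -> open V -> Cinf V f ->
  (forall y, U y -> differentiable q y) -> differentiable Y x ->
  'D_u (fun y => 'D_(Y y) f (q y)) x =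
  'D_('D_u Y x) f (q x) + 'D_('D_u q x) ('D_(Y x) f) (q x).
Proof.
move=> oU Ux UV oV sf dq dY.
have df y : U y -> differentiable f (q y) by move=> Uy; exact: Cinf_differentiable sf (UV y Uy).
have ddf i : differentiable (partial i f) (q x).
  exact: Cinf_differentiable (Cinf_derive _ sf) (UV x Ux).
have dYi i : differentiable (fun y => Y y 0 i) x.
  by apply: (@differentiable_comp _ _ _ _ Y (fun M : 'rV[R]_p => M 0 i));
    [|exact: differentiable_coord].
have dfq i : differentiable (fun y => partial i f (q y)) x.
  by apply: (@differentiable_comp _ _ _ _ q (partial i f)); [exact: dq|].
rewrite (@eq_on_derive _ _ _ U _ (fun y => \sum_i Y y 0 i *: partial i f (q y)) x u) //;
  last by move=> y Uy; exact: derive_partials (df y Uy).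
rewrite (sum_diff (fun i => differentiable_scale (dYi i) (dfq i))).2.
rewrite (derive_partials _ (df x Ux)).
under eq_bigr do rewrite (derive_scale _ (dYi _) (dfq _)).
rewrite big_split /= addrC; congr (_ + _).
  apply: eq_bigr => i _; congr (_ *: _).
  by apply: derive_coord; exact: diff_derivable.
rewrite (@eq_on_derive _ _ _ V _ (fun z => \sum_i Y x 0 i *: partial i f z) (q x)) //.
- rewrite (sum_diff _).2 => [|i]; last first.
    by apply: differentiable_scale => //; exact: differentiable_cst.
  apply: eq_bigr => i _; rewrite (derive_comp _ (dq x Ux) (ddf i)).
  by rewrite (derive_scale _ (differentiable_cst _ _) (ddf i)) derive_cst scale0r addr0.
- exact: UV.
- by move=> z Vz; apply: derive_partials; exact: Cinf_differentiable sf Vz.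
Qed.

Lemma Ck_along {n p} {W : normedModType R} k (U : set 'rV[R]_n) (V : set 'rV[R]_p)
    (q : 'rV[R]_n -> 'rV[R]_p) (Y : 'rV[R]_n -> 'rV[R]_p) (f : 'rV[R]_p -> W) :
  open U -> (forall y, U y -> V (q y)) -> Ck k U q -> Ck k U Y -> Ck k.+1 V f ->
  Ck k U (fun y => 'D_(Y y) f (q y)).
Proof.
move=> oU UV sq sY sf.
apply: (@Ck_eq _ _ _ _ _ (fun y => \sum_i Y y 0 i *: partial i f (q y))) => //.
  by move=> y Uy; rewrite -derive_partials //; apply: sf.1; exact: UV.
apply: Ck_sum => // i; apply: Ck_scale => //; first exact: Ck_coord.
by apply: (Ck_comp oU UV sq); exact: sf.2.
Qed.

End EuclideanProduct.

(** * Second fundamental form of an immersion *)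

Section BilinearTrace.
Local Open Scope ring_scope.
Context {R : realType}.

Definition bilin {m : nat} {V : lmodType R} (b : 'rV[R]_m -> 'rV[R]_m -> V) :=
  (forall a u v w, b (a *: u + v) w = a *: b u w + b v w) /\
  (forall a u v w, b w (a *: u + v) = a *: b w u + b w v).

Lemma bilin_coef {m} {V : lmodType R} (b : 'rV[R]_m -> 'rV[R]_m -> V)
    (B : 'I_m -> 'I_m -> V) :
  (forall u v, b u v = \sum_i \sum_j (u 0 i * v 0 j) *: B i j) -> bilin b.
Proof.
by move=> bE; split=> a u v w; rewrite !bE scaler_sumr -big_split;
  apply: eq_bigr => i _ /=; rewrite scaler_sumr -big_split;
  apply: eq_bigr => j _ /=; rewrite scalerA -scalerDl !mxE; congr (_ *: _); ring.
Qed.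

Section Bilin.
Context {m : nat} {V : lmodType R} (b : 'rV[R]_m -> 'rV[R]_m -> V).
Hypothesis bb : bilin b.

Lemma bilin0l w : b 0 w = 0.
Proof. by have := bb.1 (-1) 0 0 w; rewrite scaler0 addr0 scaleN1r addNr. Qed.

Lemma bilin0r w : b w 0 = 0.
Proof. by have := bb.2 (-1) 0 0 w; rewrite scaler0 addr0 scaleN1r addNr. Qed.

Lemma bilin_suml (I : finType) (a : I -> R) (F : I -> 'rV[R]_m) w :
  b (\sum_i a i *: F i) w = \sum_i a i *: b (F i) w.
Proof.
elim/big_rec2: _ => [|i u v _ <-]; first exact: bilin0l.
by rewrite bb.1.
Qed.

Lemma bilin_sumr (I : finType) (a : I -> R) (F : I -> 'rV[R]_m) w :
  b w (\sum_i a i *: F i) = \sum_i a i *: b w (F i).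
Proof.
elim/big_rec2: _ => [|i u v _ <-]; first exact: bilin0r.
by rewrite bb.2.
Qed.

Lemma bilin_trace (E : 'M[R]_m) : \sum_k b (row k E) (row k E) =
  \sum_i \sum_j (E^T *m E) i j *: b (delta_mx 0 i) (delta_mx 0 j).
Proof.
have -> : \sum_k b (row k E) (row k E) =
    \sum_k \sum_i \sum_j (E k i * E k j) *: b (delta_mx 0 i) (delta_mx 0 j).
  apply: eq_bigr => k _.
  rewrite [X in b X _](row_sum_delta (row k E)) bilin_suml; apply: eq_bigr => i _.
  rewrite [X in b _ X](row_sum_delta (row k E)) bilin_sumr scaler_sumr.
  by apply: eq_bigr => j _; rewrite scalerA !mxE.
rewrite exchange_big; apply: eq_bigr => i _; rewrite exchange_big.
apply: eq_bigr => j _; rewrite mxE scaler_suml; apply: eq_bigr => k _.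
by rewrite mxE.
Qed.

(** The trace of a bilinear map over an orthonormal basis with Gram matrix [g]
    only depends on [g], because the basis matrix satisfies [E^T E = g^-1]. *)
Lemma bilin_trace_frame (g E E' : 'M[R]_m) :
  E *m g *m E^T = 1%:M -> E' *m g *m E'^T = 1%:M ->
  \sum_k b (row k E) (row k E) = \sum_k b (row k E') (row k E').
Proof.
suff H (F : 'M[R]_m) : F *m g *m F^T = 1%:M -> F^T *m F = invmx g.
  by move=> h h'; rewrite !bilin_trace (H _ h) (H _ h').
move=> h; have [uFg uFt] := mulmx1_unit h.
have h' := mulmx1C h; rewrite mulmxA in h'.
have ug : g \in unitmx by have [_] := mulmx1_unit h'.
by rewrite -[LHS](mulmxK ug) h' mul1mx.
Qed.

End Bilin.
End BilinearTrace.

Section Immersions.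
Local Open Scope classical_set_scope.
Local Open Scope ring_scope.
Context {R : realType} {m d : nat}.

Definition gram (f : 'rV[R]_m -> 'rV[R]_d) (x : 'rV[R]_m) : 'M[R]_m :=
  \matrix_(i, j) dotp (partial i f x) (partial j f x).

(** The second fundamental form of the immersion [f] in the ambient Euclidean
    space, as a vector-valued bilinear form on coordinate vectors. *)
Definition normal_hessian (f : 'rV[R]_m -> 'rV[R]_d) (x u v : 'rV[R]_m) :
    'rV[R]_d :=
  'D_u ('D_v f) x - 'D_(christoffel_form (gram f) x u v) f x.

Definition immersion_at (f : 'rV[R]_m -> 'rV[R]_d) (x : 'rV[R]_m) :=
  forall v, 'D_v f x = 0 -> v = 0.

Context (U : set 'rV[R]_m) (f : 'rV[R]_m -> 'rV[R]_d) (x : 'rV[R]_m).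
Hypotheses (oU : open U) (Ux : U x) (sf : Cinf U f).

Let df : differentiable f x. Proof. exact: Cinf_differentiable sf Ux. Qed.

Lemma gram_form u v : (u *m gram f x *m v^T) 0 0 = dotp ('D_u f x) ('D_v f x).
Proof.
rewrite (derive_partials u df) (derive_partials v df) dotp_sumr mxE.
apply: eq_bigr => j _; rewrite dotpZr dotp_suml !mxE mulrC; congr (_ * _).
by apply: eq_bigr => i _; rewrite dotpZl !mxE.
Qed.

Lemma gramC i j : gram f x i j = gram f x j i.
Proof. by rewrite [LHS]mxE [RHS]mxE; exact: dotpC. Qed.

(** [v g = 0] makes the squared length [v g v^T] of the derivative along [v] zero. *)
Lemma gram_unit : immersion_at f x -> gram f x \in unitmx.
Proof.
move=> imf; rewrite -row_free_unit -kermx_eq0; apply/rowV0P => v /sub_kermxP v0.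
by apply: imf; apply: dotp_eq0; rewrite -gram_form v0 mul0mx mxE.
Qed.

Lemma derive2_partials u v :
  'D_u ('D_v f) x = \sum_i \sum_j (u 0 i * v 0 j) *: partial i (partial j f) x.
Proof.
have dfj j : differentiable (partial j f) x.
  exact: Cinf_differentiable (Cinf_derive _ sf) Ux.
rewrite (@eq_on_derive _ _ _ U _ (fun z => \sum_i v 0 i *: partial i f z) x u) //;
  last by move=> z Uz; apply: derive_partials; exact: Cinf_differentiable sf Uz.
rewrite (sum_diff (fun i => differentiable_scale (differentiable_cst (v 0 i) x) (dfj i))).2.
rewrite exchange_big; apply: eq_bigr => j _.
rewrite (derive_scale _ (differentiable_cst _ _) (dfj j)) derive_cst scale0r addr0.
rewrite (derive_partials _ (dfj j)) scaler_sumr; apply: eq_bigr => i _.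
by rewrite scalerA mulrC.
Qed.

Lemma christoffel_formE u v : christoffel_form (gram f) x u v =
  \sum_i \sum_j (u 0 i * v 0 j) *: \row_k christoffel (gram f) x k i j.
Proof.
apply/rowP => k; rewrite mxE summxE; apply: eq_bigr => i _.
rewrite summxE; apply: eq_bigr => j _.
by rewrite !mxE [RHS]mulrC mulrA.
Qed.

Lemma partial_gram i j l : partial i (fun y => gram f y j l) x =
  dotp (partial i (partial j f) x) (partial l f x) +
  dotp (partial j f x) (partial i (partial l f) x).
Proof.
have dfj k : differentiable (partial k f) x.
  exact: Cinf_differentiable (Cinf_derive _ sf) Ux.
have -> : (fun y => gram f y j l) = (fun y => dotp (partial j f y) (partial l f y)).
  by apply/funext => y; rewrite mxE.
by rewrite /partial (derive_dotp _ (dfj j) (dfj l)).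
Qed.

(** Each derivative of a metric coefficient is a sum of two products; by symmetry of
    second derivatives four of the six cancel. *)
Lemma koszul i j l :
  partial i (fun y => gram f y j l) x + partial j (fun y => gram f y i l) x
    - partial l (fun y => gram f y i j) x =
  2 * dotp (partial i (partial j f) x) (partial l f x).
Proof.
pose P a b := partial a (partial b f) x; pose p a := partial a f x.
have S a b : P a b = P b a by exact: schwarz oU Ux sf.
have G a b c : partial a (fun y => gram f y b c) x =
    dotp (P a b) (p c) + dotp (p b) (P a c) by exact: partial_gram.
rewrite (G i j l) (G j i l) (G l i j) -/(p l) -[partial i _ x]/(P i j).
clearbody P p.
rewrite (S j i) (S l i) (S l j) (dotpC (p j)) (dotpC (p i)).
by ring.
Qed.

Hypothesis imf : immersion_at f x.

(** Multiplying by the metric undoes the inverse metric in the Christoffel symbols. *)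
Lemma christoffel_gram i j l :
  \sum_k christoffel (gram f) x k i j * gram f x k l =
  dotp (partial i (partial j f) x) (partial l f x).
Proof.
pose q l' := dotp (partial i (partial j f) x) (partial l' f x).
have chE k : christoffel (gram f) x k i j = \sum_l' invmx (gram f x) k l' * q l'.
  rewrite /christoffel mulr_sumr; apply: eq_bigr => l' _.
  by rewrite (koszul i j l') -/(q l'); field.
rewrite -/(q l); clearbody q.
under eq_bigr do rewrite chE mulr_suml.
rewrite exchange_big /=.
have inv l' : \sum_k invmx (gram f x) k l' * gram f x k l = (l == l')%:R.
  transitivity ((gram f x *m invmx (gram f x)) l l').
    by rewrite [RHS]mxE; apply: eq_bigr => k _; rewrite (gramC k) mulrC.
  by rewrite mulmxV ?gram_unit // mxE.
transitivity (\sum_l' (l == l')%:R * q l').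
  apply: eq_bigr => l' _; rewrite -inv mulr_suml; apply: eq_bigr => k _.
  by rewrite mulrAC.
rewrite (bigD1 l) //= eqxx mul1r big1 ?addr0 // => l' l'l.
by rewrite eq_sym (negbTE l'l) mul0r.
Qed.

(** The Christoffel symbols were designed so that the tangential part of the
    Euclidean Hessian of [f] is [f' (christoffel_form u v)]: this is the Gauss
    formula. *)
Lemma normal_hessian_orth u v w : dotp (normal_hessian f x u v) ('D_w f x) = 0.
Proof.
rewrite (derive_partials w df) dotp_sumr big1 // => l _.
rewrite dotpZr /normal_hessian dotpBl derive2_partials (derive_partials _ df).
suff -> : dotp (\sum_i0 \sum_j (u 0 i0 * v 0 j) *: partial i0 (partial j f) x)
    (partial l f x) =
  dotp (\sum_i0 christoffel_form (gram f) x u v 0 i0 *: partial i0 f x)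
    (partial l f x) by rewrite subrr mulr0.
rewrite dotp_suml [RHS]dotp_suml.
transitivity (\sum_i \sum_j (u 0 i * v 0 j) *
    dotp (partial i (partial j f) x) (partial l f x)).
  apply: eq_bigr => i _; rewrite dotp_suml; apply: eq_bigr => j _.
  by rewrite dotpZl.
under [RHS]eq_bigr do rewrite dotpZl mxE mulr_suml.
rewrite [RHS]exchange_big; apply: eq_bigr => i _ /=.
under [RHS]eq_bigr do rewrite mulr_suml.
rewrite [RHS]exchange_big; apply: eq_bigr => j _ /=.
rewrite -christoffel_gram mulr_sumr; apply: eq_bigr => k _.
by rewrite [gram f x k l]mxE; ring.
Qed.

(** [normal_hessian f x u v] is the component of the Euclidean second derivative that
    is orthogonal to the image of [f'], and an orthogonal decomposition is unique. *)
Lemma normal_hessian_unique u v Z w :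
  (forall w', dotp Z ('D_w' f x) = 0) -> 'D_u ('D_v f) x - Z = 'D_w f x ->
  normal_hessian f x u v = Z.
Proof.
move=> Z0 E; apply/subr0_eq/dotp_eq0.
set c := christoffel_form (gram f) x u v.
have T : normal_hessian f x u v - Z = 'D_(w - c) f x.
  by rewrite (derive_vecB _ _ df) -E /normal_hessian addrAC.
by rewrite {2}T dotpBl normal_hessian_orth Z0 subrr.
Qed.

Lemma bilin_christoffel : bilin (christoffel_form (gram f) x).
Proof. by apply: bilin_coef => u v; exact: christoffel_formE. Qed.

Lemma bilin_normal_hessian : bilin (normal_hessian f x).
Proof.
have [cl cr] := bilin_christoffel.
have [hl hr] : bilin (fun u v => 'D_u ('D_v f) x).
  by apply: bilin_coef => u v; exact: derive2_partials.
have E a b c e : b = a *: c + e -> 'D_b f x = a *: 'D_c f x + 'D_e f x.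
  by move=> ->; exact: derive_linear.
split=> a u v w.
  apply: etrans (congr2 (fun p q => p - q) (hl a u v w) (E _ _ _ _ (cl a u v w))) _.
  by rewrite opprD addrACA scalerBr.
apply: etrans (congr2 (fun p q => p - q) (hr a u v w) (E _ _ _ _ (cr a u v w))) _.
by rewrite opprD addrACA scalerBr.
Qed.

End Immersions.

(** * Parametrized spheres *)

Section SphereParametrization.
Local Open Scope classical_set_scope.
Local Open Scope ring_scope.
Context {R : realType}.

(** The smooth left inverse [rho] makes [psi] an immersion and lets vector fields along
    [psi] be read back smoothly in coordinates. *)
Definition parametrization {n d} (V : set 'rV[R]_n) (O : set 'rV[R]_d)
    (psi : 'rV[R]_n -> 'rV[R]_d) (rho : 'rV[R]_d -> 'rV[R]_n) :=
  [/\ open V, open O, Cinf V psi, Cinf O rho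
    & forall y, V y -> O (psi y) /\ rho (psi y) = y].

Section Parametrization.
Context {n d : nat} (V : set 'rV[R]_n) (O : set 'rV[R]_d).
Context (psi : 'rV[R]_n -> 'rV[R]_d) (rho : 'rV[R]_d -> 'rV[R]_n).
Hypothesis par : parametrization V O psi rho.

Lemma param_diff y : V y -> differentiable psi y.
Proof. by case: par => _ _ s _ _; exact: Cinf_differentiable. Qed.

Lemma param_derive_inv y v : V y -> 'D_('D_v psi y) rho (psi y) = v.
Proof.
case: par => oV oO spsi srho K Vy.
have drho : differentiable rho (psi y).
  by apply: Cinf_differentiable srho _; case: (K y Vy).
rewrite -(derive_comp v (param_diff Vy) drho).
rewrite (@eq_on_derive _ _ _ V _ id y v) ?derive_id //.
by move=> z /K[].
Qed.

Lemma param_immersion y : V y -> immersion_at psi y.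
Proof. by move=> Vy v v0; rewrite -(param_derive_inv v Vy) v0 derive0. Qed.

(** A field of coordinate vectors is as smooth as the ambient vector field that
    it represents. *)
Lemma Cinf_pull {m} (W : set 'rV[R]_m) (f : 'rV[R]_m -> 'rV[R]_n)
    (Y : 'rV[R]_m -> 'rV[R]_n) (F : 'rV[R]_m -> 'rV[R]_d) :
  open W -> Cinf W f -> (forall y, W y -> V (f y)) ->
  Cinf W F -> (forall y, W y -> 'D_(Y y) psi (f y) = F y) -> Cinf W Y.
Proof.
case: par => oV oO spsi srho K oW sf WV sF E k.
apply: (@Ck_eq _ _ _ _ W (fun y => 'D_(F y) rho (psi (f y)))) => //.
  by move=> y Wy; rewrite -E // param_derive_inv //; exact: WV.
apply: (@Ck_along _ _ _ _ k W O (fun y => psi (f y)) F rho) => //.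
- by move=> y /WV /K[].
- exact: (@Ck_comp _ _ _ _ k W V f psi).
Qed.

End Parametrization.

Section Sphere.
Context {n d : nat} (V : set 'rV[R]_n) (O : set 'rV[R]_d).
Context (psi : 'rV[R]_n -> 'rV[R]_d) (rho : 'rV[R]_d -> 'rV[R]_n) (r2 : R).
Hypothesis par : parametrization V O psi rho.
Hypothesis psi_sphere : forall y, V y -> dotp (psi y) (psi y) = r2.
Hypothesis r2_neq0 : r2 != 0.
Hypothesis dim : d = n.+1.

Lemma sphere_tangent y v : V y -> dotp ('D_v psi y) (psi y) = 0.
Proof.
case: (par) => oV _ _ _ _ Vy; have dy := param_diff par Vy.
have := derive_dotp v dy dy.
rewrite (@eq_on_derive _ _ _ V _ (cst r2) y v) // derive_cst.
rewrite [dotp (psi y) _]dotpC => /esym/eqP.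
by rewrite -mulr2n mulrn_eq0 /= => /eqP.
Qed.

(** The derivatives of [psi] and [psi] itself are n + 1 independent vectors, hence span
    the ambient space. *)
Lemma sphere_spanning y Z : V y -> (forall w, dotp Z ('D_w psi y) = 0) ->
  dotp Z (psi y) = 0 -> Z = 0.
Proof.
move=> Vy Zt Zn; have dy := param_diff par Vy.
pose A := col_mx (jacobian psi y) (psi y).
have freeA : row_free A.
  rewrite -kermx_eq0; apply/rowV0P => v /sub_kermxP.
  pose a := lsubmx v; pose t := rsubmx v 0 0.
  have -> : v = row_mx a t%:M by rewrite -mx11_scalar hsubmxK.
  rewrite mul_row_col -(deriveEjacobian _ dy) mul_scalar_mx => H.
  have t0 : t = 0.
    have := congr1 (fun u => dotp u (psi y)) H.
    rewrite dotpDl dotpZl sphere_tangent // psi_sphere // dotp0l add0r => /eqP.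
    by rewrite mulf_eq0 (negbTE r2_neq0) orbF => /eqP.
  move: H; rewrite t0 scale0r addr0 => /(param_immersion par Vy) ->.
  by rewrite raddf0 row_mx0.
have fullA : row_full A by rewrite /row_full (eqP freeA) dim addn1.
have [B BA] := row_fullP fullA.
have ZA : Z *m A^T = 0.
  rewrite /A tr_col_mx mul_mx_row -[RHS]row_mx0; congr row_mx; apply/rowP => j.
    rewrite [RHS]mxE -(Zt (delta_mx 0 j)) (deriveEjacobian _ dy) -rowE.
    by rewrite mxE; apply: eq_bigr => i _; rewrite !mxE.
  by rewrite (ord1 j) dotp_mulmx Zn mxE.
rewrite -[Z]mulmx1 -[1%:M]trmx1 -BA trmx_mul mulmxA ZA mul0mx //.
Qed.

(** The form is a multiple of the position vector, the only normal direction; the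
    factor comes from differentiating the orthogonality of 'D_v psi and psi. *)
Lemma sphere_normal_hessian y u v : V y -> normal_hessian psi y u v =
  - (r2^-1 * dotp ('D_u psi y) ('D_v psi y)) *: psi y.
Proof.
case: (par) => oV _ spsi _ _ Vy; have dy := param_diff par Vy.
have ddy : differentiable ('D_v psi) y by exact: Cinf_differentiable (Cinf_derive _ spsi) Vy.
set a := dotp ('D_u psi y) ('D_v psi y).
have H : dotp ('D_u ('D_v psi) y) (psi y) = - a.
  have := derive_dotp u ddy dy.
  rewrite (@eq_on_derive _ _ _ V _ (cst 0) y u) //; last by move=> z; exact: sphere_tangent.
  rewrite derive_cst [dotp ('D_v psi y) _]dotpC -/a => /esym/eqP.
  by rewrite addr_eq0 => /eqP.
apply/subr0_eq; rewrite scaleNr opprK; apply: (sphere_spanning Vy) => [w|].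
  rewrite dotpDl dotpZl [dotp (psi y) _]dotpC sphere_tangent // mulr0 addr0.
  exact: normal_hessian_orth oV Vy spsi (param_immersion par Vy) u v w.
rewrite dotpDl dotpZl psi_sphere // /normal_hessian dotpBl H sphere_tangent //.
by rewrite subr0 mulrAC mulVf // mul1r addNr.
Qed.

Lemma derive2_sphere y u v : V y -> 'D_u ('D_v psi) y =
  'D_(christoffel_form (gram psi) y u v) psi y
  - (r2^-1 * dotp ('D_u psi y) ('D_v psi y)) *: psi y.
Proof.
by move=> Vy; rewrite -scaleNr -sphere_normal_hessian // addrC subrK.
Qed.

End Sphere.
End SphereParametrization.

(** * Tension and Jacobi operators of maps into a sphere *)

Section MapsIntoSphere.
Local Open Scope classical_set_scope.
Local Open Scope ring_scope.
Context {R : realType} {n d : nat}.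
Context (V : set 'rV[R]_n) (O : set 'rV[R]_d).
Context (psi : 'rV[R]_n -> 'rV[R]_d) (rho : 'rV[R]_d -> 'rV[R]_n) (r2 : R).
Hypothesis par : parametrization V O psi rho.
Hypothesis psi_sphere : forall y, V y -> dotp (psi y) (psi y) = r2.
Hypothesis r2_neq0 : r2 != 0.
Hypothesis dim : d = n.+1.

Let h := gram psi.

Section Pullback.
Context {m : nat} (W : set 'rV[R]_m) (f : 'rV[R]_m -> 'rV[R]_d).
Context (phi : 'rV[R]_m -> 'rV[R]_n).
Hypotheses (oW : open W) (sf : Cinf W f) (sphi : Cinf W phi).
Hypothesis phiV : forall y, W y -> V (phi y).
Hypothesis psi_phi : forall y, W y -> psi (phi y) = f y.

Lemma push_dmap x v : W x -> 'D_('D_v phi x) psi (phi x) = 'D_v f x.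
Proof.
move=> Wx; have dphi := Cinf_differentiable sphi Wx.
rewrite -(derive_comp v dphi (param_diff par (phiV Wx))).
exact: eq_on_derive oW Wx psi_phi.
Qed.

(** By the Gauss formula of the sphere, the Christoffel term completes the derivative
    of the transported field up to a multiple of the position vector. *)
Lemma push_nabla X Y x : W x -> differentiable Y x ->
  'D_(nabla_pullback h phi X Y x) psi (phi x) =
  'D_(X x) (fun y => 'D_(Y y) psi (phi y)) x
  + (r2^-1 * dotp ('D_(X x) f x) ('D_(Y x) psi (phi x))) *: f x.
Proof.
case: (par) => oV _ spsi _ _ Wx dY; have dpsi := param_diff par (phiV Wx).
rewrite /nabla_pullback (derive_vecD _ _ dpsi).
have dphi y : W y -> differentiable phi y by exact: Cinf_differentiable.
rewrite (@derive_along _ _ _ _ W V phi Y psi x (X x) oW Wx phiV oV spsi dphi dY).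
rewrite (derive2_sphere par psi_sphere r2_neq0 dim _ _ (phiV Wx)).
rewrite (push_dmap (X x) Wx) (psi_phi Wx) -[RHS]addrA; congr (_ + _).
exact: esym (subrK _ _).
Qed.

Lemma Cinf_dmap Y : Cinf W Y -> Cinf W (dmap phi Y).
Proof.
move=> sY k; apply: (@Ck_along _ _ _ _ k W W id Y phi) => //.
exact: Ck_id.
Qed.

(** In the ambient space the second fundamental form of a map into the sphere is the
    Euclidean one plus the normal curvature of the sphere. *)
Lemma push_second_fundamental_form X Y x : W x -> Cinf W Y ->
  'D_(second_fundamental_form (gram f) h phi X Y x) psi (phi x) =
  normal_hessian f x (X x) (Y x)
  + (r2^-1 * dotp ('D_(X x) f x) ('D_(Y x) f x)) *: f x.
Proof.
move=> Wx sY; have dpsi := param_diff par (phiV Wx).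
have df := Cinf_differentiable sf Wx.
have E : second_fundamental_form (gram f) h phi X Y x =
    nabla_pullback h phi X (dmap phi Y) x - 'D_(nabla (gram f) X Y x) phi x by [].
have did y : W y -> differentiable (id : 'rV[R]_m -> _) y by move=> _; exact: ex_diff.
have dYphi : 'D_(X x) (fun y => 'D_(dmap phi Y y) psi (phi y)) x =
    'D_('D_(X x) Y x) f x + 'D_(X x) ('D_(Y x) f) x.
  apply: etrans (eq_on_derive (X x) oW Wx (fun y Wy => push_dmap (Y y) Wy)) _.
  have := @derive_along _ _ _ _ W W id Y f x (X x) oW Wx (fun y Wy => Wy) oW sf did
    (Cinf_differentiable sY Wx).
  by rewrite derive_id; exact.
have Ynabla := push_nabla X Wx (Cinf_differentiable (Cinf_dmap sY) Wx).
rewrite dYphi in Ynabla.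
have Ydmap : 'D_(dmap phi Y x) psi (phi x) = 'D_(Y x) f x by exact: push_dmap.
rewrite Ydmap in Ynabla.
have Nabla := etrans (push_dmap (nabla (gram f) X Y x) Wx) (derive_vecD _ _ df).
rewrite E; apply: etrans (derive_vecB _ _ dpsi) _.
apply: etrans (congr2 (fun a b => a - b) Ynabla Nabla) _.
by rewrite [LHS]addrAC opprD addrACA subrr add0r.
Qed.

Section Tension.
Context (e : 'I_m -> 'rV[R]_m -> 'rV[R]_m).
Hypothesis se : forall i, Cinf W (e i).
Hypothesis e_orth : forall y, W y -> forall i j,
  dotp ('D_(e i y) f y) ('D_(e j y) f y) = (i == j)%:R.

Lemma push_tension y : W y ->
  'D_(tension_field (gram f) h phi e y) psi (phi y) =
  \sum_i normal_hessian f y (e i y) (e i y) + (m%:R * r2^-1) *: f y.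
Proof.
move=> Wy; have dpsi := param_diff par (phiV Wy).
have -> : tension_field (gram f) h phi e y =
    \sum_i second_fundamental_form (gram f) h phi (e i) (e i) y.
  by rewrite /tension_field fct_sumE.
apply: etrans (derive_vec_sum _ dpsi) _.
transitivity (\sum_i (normal_hessian f y (e i y) (e i y) + r2^-1 *: f y)).
  apply: eq_bigr => i _; rewrite (push_second_fundamental_form (e i) Wy (se i)).
  by rewrite e_orth // eqxx mulr1.
rewrite big_split /=; congr (_ + _).
by rewrite sumr_const card_ord -scaler_nat scalerA.
Qed.

End Tension.
End Pullback.

Section Curvature.

(** The Levi-Civita connection is the pull-back connection of the identity. *)
Lemma push_levi_civita X Y y : V y -> differentiable Y y ->
  'D_(nabla h X Y y) psi y = 'D_(X y) (fun z => 'D_(Y z) psi z) y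
    + (r2^-1 * dotp ('D_(X y) psi y) ('D_(Y y) psi y)) *: psi y.
Proof.
case: (par) => oV _ spsi _ _ Vy dY.
have := @push_nabla n V psi id oV (fun k => Ck_id k oV) (fun _ h => h)
  (fun _ _ => erefl) X Y y Vy dY.
by rewrite /nabla_pullback /dmap derive_id; exact.
Qed.

(** The sphere has constant curvature. Third derivatives of the parametrization
    cancel by symmetry, and the remaining component along the position vector
    vanishes because the curvature is a tangent vector. *)
Lemma push_curvature y u v w : V y ->
  'D_(curvature h y u v w) psi y =
  r2^-1 *: (dotp ('D_v psi y) ('D_w psi y) *: 'D_u psi y
            - dotp ('D_u psi y) ('D_w psi y) *: 'D_v psi y).
Proof.
case: (par) => oV _ spsi _ _ Vy; have dpsi := param_diff par Vy.
pose a v w z := r2^-1 * dotp ('D_v psi z) ('D_w psi z).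
pose N v w := nabla h (fun=> v) (fun=> w).
pose F v w z := 'D_v ('D_w psi) z + a v w z *: psi z.
have NF v' w' z : V z -> 'D_(N v' w' z) psi z = F v' w' z.
  by move=> Vz; exact: (push_levi_civita (fun=> v') Vz (differentiable_cst w' z)).
have sa v' w' k : Ck k V (a v' w').
  apply: (@Ck_scale _ _ _ k V (fun=> r2^-1)) => //; first exact: Ck_cst.
  by apply: Ck_dotp => //; exact: Cinf_derive spsi k.
have sF v' w' : Cinf V (F v' w').
  move=> k; apply: Ck_add => //; last exact: Ck_scale.
  exact: (Cinf_derive _ (Cinf_derive _ spsi)) k.
have sN v' w' : Cinf V (N v' w').
  apply: (@Cinf_pull _ _ _ V O psi rho par _ V id (N v' w') (F v' w')) => //.
    by move=> k; exact: Ck_id.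
  exact: NF.
have HN u' v' : exists s, 'D_(nabla h (fun=> u') (N v' w) y) psi y =
    'D_u' ('D_v' ('D_w psi)) y + a v' w y *: 'D_u' psi y + s *: psi y.
  have da : differentiable (a v' w) y by exact: (sa v' w 1%N).1.
  have d3 : differentiable ('D_v' ('D_w psi)) y.
    exact: Cinf_differentiable (Cinf_derive _ (Cinf_derive _ spsi)) Vy.
  have dap := differentiable_scale da dpsi.
  have E := push_levi_civita (fun=> u') Vy (Cinf_differentiable (sN v' w) Vy).
  have DF := eq_on_derive u' oV Vy (NF v' w).
  have DF' := etrans (derive_add u' d3 dap) (congr1 _ (derive_scale u' da dpsi)).
  eexists; apply: etrans E _.
  apply: etrans (congr1 (fun b => b + _) (etrans DF DF')) _.
  by rewrite -!addrA -scalerDl.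
have [s1 E1] := HN u v; have [s2 E2] := HN v u.
have E3 : nabla h (lie_bracket (fun=> u) (fun=> v)) (fun=> w) y = 0.
  rewrite /nabla /lie_bracket !derive_cst subrr add0r.
  exact: bilin0l (bilin_christoffel psi y) w.
have E : curvature h y u v w = nabla h (fun=> u) (N v w) y
    - nabla h (fun=> v) (N u w) y.
  by rewrite -[RHS]subr0 -E3.
have S : 'D_u ('D_v ('D_w psi)) y = 'D_v ('D_u ('D_w psi)) y.
  exact: schwarz oV Vy (Cinf_derive _ spsi).
have P : 'D_(curvature h y u v w) psi y =
    a v w y *: 'D_u psi y - a u w y *: 'D_v psi y + (s1 - s2) *: psi y.
  rewrite E; apply: etrans (derive_vecB _ _ dpsi) _.
  have sub3 (T T' A B C C' b c : 'rV[R]_d) : T = T' -> b = T + A + C ->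
      c = T' + B + C' -> b - c = A - B + (C - C').
    by move=> -> -> ->; rewrite -(addrA T' A) -(addrA T' B) opprD addrACA subrr add0r opprD addrACA.
  by rewrite scalerBl; exact: sub3 S E1 E2.
have s0 : (s1 - s2) * r2 = 0.
  have comp (X A B C : 'rV[R]_d) (b c s : R) : X = b *: A - c *: B + s *: C ->
      dotp X C = 0 -> dotp A C = 0 -> dotp B C = 0 -> s * dotp C C = 0.
    move=> -> XC AC BC; move: XC.
    by rewrite dotpDl dotpBl !dotpZl AC BC !mulr0 subrr add0r.
  have tan z : dotp ('D_z psi y) (psi y) = 0 by exact: sphere_tangent par psi_sphere _ _ Vy.
  by rewrite -(psi_sphere Vy); exact: comp P (tan _) (tan _) (tan _).
move/eqP: s0; rewrite mulf_eq0 (negbTE r2_neq0) orbF => /eqP s0.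
apply: etrans P _; rewrite s0 scale0r addr0 [RHS]scalerBr.
by congr (_ - _); rewrite [RHS]scalerA.
Qed.

End Curvature.

Section Jacobi.
Context {m : nat} (W : set 'rV[R]_m) (f : 'rV[R]_m -> 'rV[R]_d).
Context (phi : 'rV[R]_m -> 'rV[R]_n).
Hypotheses (oW : open W) (sf : Cinf W f) (sphi : Cinf W phi).
Hypothesis phiV : forall y, W y -> V (phi y).
Hypothesis psi_phi : forall y, W y -> psi (phi y) = f y.
Context (e : 'I_m -> 'rV[R]_m -> 'rV[R]_m).
Hypothesis se : forall i, Cinf W (e i).
Hypothesis e_orth : forall y, W y -> forall i j,
  dotp ('D_(e i y) f y) ('D_(e j y) f y) = (i == j)%:R.
Context (L : {linear 'rV[R]_d -> 'rV[R]_d}) (T : 'rV[R]_m -> 'rV[R]_n).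
Hypothesis push_T : forall y, W y -> 'D_(T y) psi (phi y) = L (f y).
Hypothesis L_normal : forall y v, W y -> dotp ('D_v f y) (L (f y)) = 0.

Let cL : continuous L. Proof. exact: linear_rV_continuous. Qed.

Let sLf : Cinf W (fun y => L (f y)).
Proof. by move=> k; exact: Ck_linear. Qed.

Let sT : Cinf W T.
Proof. exact: (Cinf_pull par oW sphi phiV sLf push_T). Qed.

(** As [L f] is a normal field along [f], its covariant derivative in the sphere
    is the plain derivative, [L] applied to the tangent vector. *)
Lemma push_nabla_T X y : W y ->
  'D_(nabla_pullback h phi X T y) psi (phi y) = L ('D_(X y) f y).
Proof.
move=> Wy; have df := Cinf_differentiable sf Wy.
have E := push_nabla oW sphi phiV psi_phi X Wy (Cinf_differentiable sT Wy).
have D := etrans (eq_on_derive (X y) oW Wy push_T) (derive_post_linear (X y) cL df).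
apply: etrans E _; apply: etrans (congr1 (fun b => b + _) D) _.
have -> : dotp ('D_(X y) f y) ('D_(T y) psi (phi y)) = 0.
  by apply: etrans (congr1 (dotp _) (push_T Wy)) _; exact: L_normal.
by rewrite mulr0 scale0r addr0.
Qed.

(** The second derivative of [L f] is [L] applied to the second derivative of [f], plus
    the correction along the position vector; the term in [nabla (e i) (e i)]
    turns the second derivative into the normal Hessian. *)
Lemma push_nabla2_T i x : W x ->
  'D_(nabla_pullback h phi (e i) (nabla_pullback h phi (e i) T) x
      - nabla_pullback h phi (nabla (gram f) (e i) (e i)) T x) psi (phi x) =
  L (normal_hessian f x (e i x) (e i x))
  + (r2^-1 * dotp ('D_(e i x) f x) (L ('D_(e i x) f x))) *: f x.
Proof.
move=> Wx; have df := Cinf_differentiable sf Wx.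
have dpsi := param_diff par (phiV Wx).
pose Y y := 'D_(e i y) f y.
have sY : Cinf W Y.
  by move=> k; apply: (@Ck_along _ _ _ _ k W W id (e i) f) => //;
    [exact: Ck_id|exact: (se i k)].
have dY := Cinf_differentiable sY Wx.
have sLY : Cinf W (fun y => L (Y y)) by move=> k; exact: Ck_linear.
have sP := Cinf_pull par oW sphi phiV sLY (fun y Wy => push_nabla_T (e i) Wy).
have E := push_nabla oW sphi phiV psi_phi (e i) Wx (Cinf_differentiable sP Wx).
have D := etrans (eq_on_derive (e i x) oW Wx (fun y Wy => push_nabla_T (e i) Wy))
  (derive_post_linear (e i x) cL dY).
have did y : W y -> differentiable (id : 'rV[R]_m -> _) y by move=> _; exact: ex_diff.
have A := @derive_along _ _ _ _ W W id (e i) f x (e i x) oW Wx (fun y Wy => Wy) oW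
  sf did (Cinf_differentiable (se i) Wx).
rewrite derive_id in A.
have B := push_nabla_T (nabla (gram f) (e i) (e i)) Wx.
have N : 'D_(nabla (gram f) (e i) (e i) x) f x = _ := derive_vecD _ _ df.
have G : dotp ('D_(e i x) f x) ('D_(nabla_pullback h phi (e i) T x) psi (phi x)) =
    dotp ('D_(e i x) f x) (L ('D_(e i x) f x)).
  by congr (dotp _ _); exact: push_nabla_T.
apply: etrans (derive_vecB _ _ dpsi) _.
have fin (p q c z b b' : 'rV[R]_d) : b = L (p + q) + z -> b' = L (p + c) ->
    b - b' = L (q - c) + z.
  by move=> -> ->; rewrite addrAC -linearB opprD addrACA subrr add0r.
apply: fin; last exact: etrans B (congr1 L N).
apply: etrans E (congr2 +%R _ (congr1 (fun b => (r2^-1 * b) *: f x) G)).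
exact: etrans D (congr1 L A).
Qed.

(** The curvature term is the trace of [R(T, e_i) e_i], that is [m / r2] times the
    normal field [T]; the hypothesis says that the rough Laplacian is its opposite. *)
Lemma jacobi_operator_eq0 x : W x ->
  \sum_i (L (normal_hessian f x (e i x) (e i x))
    + (r2^-1 * dotp ('D_(e i x) f x) (L ('D_(e i x) f x))) *: f x)
    = - (m%:R * r2^-1) *: L (f x) ->
  jacobi_operator (gram f) h phi e T x = 0.
Proof.
move=> Wx H; have dpsi := param_diff par (phiV Wx).
apply: (param_immersion par (phiV Wx)).
pose Q i := nabla_pullback h phi (e i) (nabla_pullback h phi (e i) T) x
  - nabla_pullback h phi (nabla (gram f) (e i) (e i)) T x.
pose C i := curvature h (phi x) (T x) (dmap phi (e i) x) (dmap phi (e i) x).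
have -> : jacobi_operator (gram f) h phi e T x = 0 - \sum_i Q i - \sum_i C i.
  by rewrite sub0r.
have DQ : 'D_(\sum_i Q i) psi (phi x) = - (m%:R * r2^-1) *: L (f x).
  apply: etrans (derive_vec_sum _ dpsi) _; rewrite -H; apply: eq_bigr => i _.
  exact: push_nabla2_T.
have DC : 'D_(\sum_i C i) psi (phi x) = (m%:R * r2^-1) *: L (f x).
  apply: etrans (derive_vec_sum _ dpsi) _.
  transitivity (\sum_(i < m) r2^-1 *: L (f x)); last first.
    by rewrite sumr_const card_ord -scaler_nat scalerA.
  apply: eq_bigr => i _; apply: etrans (push_curvature _ _ _ (phiV Wx)) _.
  have Ei : 'D_(dmap phi (e i) x) psi (phi x) = 'D_(e i x) f x.
    exact: (push_dmap oW sphi phiV psi_phi _ Wx).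
  rewrite Ei (push_T Wx) e_orth // eqxx scale1r.
  by rewrite [dotp (L _) _]dotpC L_normal // scale0r subr0.
apply: etrans (derive_vecB _ _ dpsi) _.
have D0 := etrans (derive_vecB 0 (\sum_i Q i) dpsi) (congr2 (fun a b => a - b) (derive0 _ _) DQ).
apply: etrans (congr2 (fun a b => a - b) D0 DC) _.
by rewrite sub0r scaleNr opprK subrr.
Qed.

End Jacobi.
End MapsIntoSphere.

(** * Orthonormal frames *)

Section OrthonormalFrames.
Local Open Scope classical_set_scope.
Local Open Scope ring_scope.
Context {R : realType} {m d : nat}.
Context (W : set 'rV[R]_m) (f : 'rV[R]_m -> 'rV[R]_d).
Hypotheses (oW : open W) (sf : Cinf W f).
Hypothesis imf : forall y, W y -> immersion_at f y.

Let df y : W y -> differentiable f y. Proof. exact: Cinf_differentiable. Qed.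

Let pairing (y u v : 'rV[R]_m) : R := dotp ('D_u f y) ('D_v f y).

Let bil y : W y -> bilin (pairing y : 'rV[R]_m -> 'rV[R]_m -> R^o).
Proof.
have C u v : pairing y u v = pairing y v u by exact: dotpC.
move=> /df dfy.
have l a u v w : pairing y (a *: u + v) w = a * pairing y u w + pairing y v w.
  by rewrite /pairing (derive_linear a u v dfy) dotpPl.
split=> a u v w; first exact: l.
exact: etrans (C _ _) (etrans (l a u v w) (congr2 (fun b c => a * b + c) (C _ _) (C _ _))).
Qed.

Lemma Cinf_pairing (Y Z : 'rV[R]_m -> 'rV[R]_m) : Cinf W Y -> Cinf W Z ->
  Cinf W (fun y => pairing y (Y y) (Z y)).
Proof.
have A (X : 'rV[R]_m -> 'rV[R]_m) : Cinf W X -> Cinf W (fun y => 'D_(X y) f y).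
  by move=> sX k; apply: (@Ck_along _ _ _ _ k W W id X f) => //; exact: Ck_id.
by move=> sY sZ k; exact: Ck_dotp (A Y sY k) (A Z sZ k).
Qed.

(** Gram-Schmidt: after [k] steps the fields of index at least [k] are zero,
    which lets the projection be written as a sum over all indices. The fields
    are triangular in coordinates, so that the vector left by the projection
    still has a coordinate equal to 1. *)
Lemma gram_schmidt k : (k <= m)%N -> exists e : 'I_m -> 'rV[R]_m -> 'rV[R]_m,
  [/\ forall i, Cinf W (e i),
      forall y, W y -> forall i j,
        pairing y (e i y) (e j y) = ((i == j) && (i < k)%N)%:R,
      forall (i : 'I_m) y, (k <= i)%N -> e i y = 0
    & forall (i : 'I_m) y (j : 'I_m), (i < j)%N -> e i y 0 j = 0].
Proof.
elim: k => [_|k IH km].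
  exists (fun _ _ => 0); split.
  - by move=> i k; exact: Ck_cst.
  - by move=> y _ i j; rewrite andbF /pairing derive0 dotp0l.
  - by [].
  - by move=> i y j _; rewrite mxE.
have [e [se oe e0 te]] := IH (ltnW km); pose K := Ordinal km.
pose v y := delta_mx 0 K - \sum_i pairing y (delta_mx 0 K) (e i y) *: e i y : 'rV[R]_m.
have sv : Cinf W v.
  move=> l; apply: Ck_add => //; first exact: Ck_cst.
  apply: (@Ck_eq _ _ _ l W (fun y => -1 *: (\sum_i pairing y (delta_mx 0 K) (e i y) *: e i y))) => //.
    by move=> y _; rewrite scaleN1r.
  apply: (@Ck_scale _ _ _ l W (fun=> -1)) => //; first exact: Ck_cst.
  apply: Ck_sum => // i; apply: Ck_scale => //; last exact: se.
  by apply: (@Cinf_pairing (fun=> delta_mx 0 K) (e i)) => // l'; exact: Ck_cst.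
have vcoord y (j : 'I_m) : (k <= j)%N -> v y 0 j = (j == K)%:R.
  move=> kj; rewrite !mxE summxE big1 ?subr0 // => i _.
  rewrite !mxE; have [ki|ik] := leqP k i; first by rewrite e0 // mxE mulr0.
  by rewrite te ?mulr0 //; exact: leq_trans kj.
have vorth y j : W y -> pairing y (v y) (e j y) = 0.
  move=> Wy; have -> : pairing y (v y) (e j y) = pairing y (delta_mx 0 K) (e j y) -
      \sum_i pairing y (delta_mx 0 K) (e i y) * pairing y (e i y) (e j y).
    rewrite -(bilin_suml (bil Wy) (fun i => pairing y (delta_mx 0 K) (e i y)) (e^~ y)).
    by rewrite -mulN1r addrC -(bil Wy).1 scaleN1r addrC.
  rewrite (bigD1 j) //= oe // eqxx /= big1 => [|i ij]; last first.
    by rewrite oe // (negbTE ij) mulr0.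
  have [kj|jk] := leqP k j; last by rewrite mulr1 addr0 subrr.
  by rewrite e0 // (bilin0r (bil Wy)) mul0r addr0 subrr.
pose N y := pairing y (v y) (v y).
have N0 y : W y -> 0 < N y.
  move=> Wy; rewrite lt_neqAle dotp_ge0 andbT eq_sym; apply/eqP => /dotp_eq0 v0.
  have := vcoord y K (leqnn k); rewrite (imf Wy v0) mxE eqxx => /esym/eqP.
  by rewrite oner_eq0.
pose c y := N y `^ (- 2^-1); pose w y := c y *: v y.
have sw : Cinf W w.
  move=> l; apply: Ck_scale => //; apply: Ck_powR => //.
  exact: Cinf_pairing.
have wE y u : W y -> pairing y (w y) u = c y * pairing y (v y) u.
  by move=> Wy; rewrite /pairing /w (derive_vecZ (c y) (v y) (df Wy)) dotpZl.
have wv y : W y -> c y * (c y * N y) = 1.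
  move=> Wy; have N0y := N0 y Wy; rewrite mulrA /c -powRD; last first.
    by apply/implyP => _; rewrite gt_eqF.
  have -> : - 2^-1 - 2^-1 = -1 :> R by field.
  by rewrite powR_inv1 ?(ltW N0y) // mulVf // gt_eqF.
exists (fun i y => if i == K then w y else e i y); split.
- by move=> i; case: (i == K).
- have pairC y a b : pairing y a b = pairing y b a by exact: dotpC.
  move=> y Wy i j; have [->|iK] := eqVneq i K; have [jE|jK] := eqVneq j K.
  + rewrite ltnS leqnn wE // pairC wE //; exact: wv.
  + by rewrite wE // vorth // mulr0.
  + by rewrite pairC wE // vorth // mulr0 jE (negbTE iK).
  + rewrite oe //; have [->|] := eqVneq i j => //=; rewrite [in RHS]ltnS [in RHS]leq_eqVlt.
    by rewrite (_ : (j == k :> nat) = false) //; exact/negbTE.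
- move=> i y ki; have [E|iK] := eqVneq i K; first by rewrite E ltnn in ki.
  by rewrite e0 // ltnW.
- move=> i y j ij; have [E|iK] := eqVneq i K; last exact: te.
  rewrite E in ij; rewrite mxE vcoord; last exact: ltnW.
  by rewrite (_ : (j == K) = false) ?mulr0 //; apply/negbTE; rewrite eq_sym neq_ltn ij.
Qed.

Lemma exists_orthonormal_frame : exists e : 'I_m -> 'rV[R]_m -> 'rV[R]_m,
  (forall i, Cinf W (e i)) /\
  forall y, W y -> forall i j, dotp ('D_(e i y) f y) ('D_(e j y) f y) = (i == j)%:R.
Proof.
have [e [se oe _ _]] := gram_schmidt (leqnn m); exists e; split=> // y Wy i j.
by have := oe y Wy i j; rewrite ltn_ord andbT.
Qed.

End OrthonormalFrames.

(** * Charts of spheres and products *)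

Section SubmanifoldCharts.
Local Open Scope classical_set_scope.
Local Open Scope ring_scope.
Context {R : realType}.

Lemma embedded_chart_parametrization {d n} (M : set 'rV[R]_d) (c : chart R 'rV[R]_d n) :
  embedded_chart M c -> parametrization (ccod c) (cnbhd c) (cbwd c) (cfwd c).
Proof.
move=> [[oN oC _ K] sF sB]; split=> //; try exact: smooth_on_Cinf.
by move=> y /K[].
Qed.

Lemma Cinf_linear {n} {W : normedModType R} (U : set 'rV[R]_n)
    (L : {linear 'rV[R]_n -> W}) : open U -> Cinf U L.
Proof.
move=> oU k; apply: (@Ck_linear _ _ _ _ k U L id) => //; last exact: Ck_id.
exact: linear_rV_continuous.
Qed.

Lemma Ck_row_mx {n d1 d2} k (U : set 'rV[R]_n) (f1 : 'rV[R]_n -> 'rV[R]_d1)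
    (f2 : 'rV[R]_n -> 'rV[R]_d2) : open U -> Ck k U f1 -> Ck k U f2 ->
  Ck k U (fun y => row_mx (f1 y) (f2 y)).
Proof.
move=> oU s1 s2; apply: Ck_rV => // j; case: (split_ordP j) => i ->.
  apply: (@Ck_eq _ _ _ k U (fun y => f1 y 0 i)) => //; last exact: Ck_coord.
  by move=> y _; rewrite row_mxEl.
apply: (@Ck_eq _ _ _ k U (fun y => f2 y 0 i)) => //; last exact: Ck_coord.
by move=> y _; rewrite row_mxEr.
Qed.

Lemma Ck_inv {n} k (U : set 'rV[R]_n) (a : 'rV[R]_n -> R) : open U ->
  (forall y, U y -> 0 < a y) -> Ck k U a -> Ck k U (fun y => (a y)^-1).
Proof.
move=> oU a0 sa; apply: (@Ck_eq _ _ _ k U (fun y => a y `^ (-1))) => //.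
  by move=> y Uy; rewrite powR_inv1 // ltW // a0.
exact: Ck_powR.
Qed.

(** Stereographic projection from the pole [(s, 0)] of the unit sphere, with
    [s] a sign. *)
Definition stereographic {n} (s : R) : chart R 'rV[R]_(1 + n) n :=
  Chart [set x | s * lsubmx x 0 0 < 1] setT
    (fun x => (1 - s * lsubmx x 0 0)^-1 *: rsubmx x)
    (fun y => (dotp y y + 1)^-1 *:
      row_mx (const_mx (s * (dotp y y - 1)) : 'rV[R]_1) (2 *: y)).

Lemma embedded_stereographic {n} (s : R) : s * s = 1 ->
  embedded_chart (sphere 1 : set 'rV[R]_(1 + n)) (stereographic s).
Proof.
move=> ss.
pose t (x : 'rV[R]_(1 + n)) := lsubmx x 0 0.
have normE (x : 'rV[R]_(1 + n)) : dotp x x = t x ^+ 2 + dotp (rsubmx x) (rsubmx x).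
  by rewrite -{1 2}[x]hsubmxK dotp_row_mx [dotp (lsubmx x) _]big_ord1 expr2.
have st (U : set _) k : open U -> Ck k U t.
  move=> oU; apply: (@Ck_coord _ _ _ k U (fun x => lsubmx x)) => //.
  exact: Cinf_linear oU k.
have sK (U : set _) k : open U -> Ck k U (fun x => 1 - s * t x).
  move=> oU; apply: (@Ck_add _ _ _ k U (fun=> 1 : R) (fun x => - (s * t x)) oU); first exact: Ck_cst.
  apply: (@Ck_eq _ _ _ k U (fun x => (- s) *: t x)) => //.
    by move=> x _; rewrite -mulNr.
  by apply: (@Ck_scale _ _ _ k U (fun=> - s)) => //; [exact: Ck_cst|exact: st].
have oN : open [set x | s * t x < 1].
  rewrite (_ : [set x | s * t x < 1] = (fun x => 1 - s * t x) @^-1` [set z | 0 < z]).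
    apply: open_comp; last exact: open_gt.
    move=> x _; apply: differentiable_continuous.
    by apply: (sK setT 1%N openT).1.
  by apply/seteqP; split=> x /=; rewrite subr_gt0.
have q0 (y : 'rV[R]_n) : 0 < dotp y y + 1 by rewrite ltr_wpDl // dotp_ge0.
pose B (y : 'rV[R]_n) := cbwd (stereographic s) y.
have tB y : t (B y) = s * ((dotp y y - 1) / (dotp y y + 1)).
  by rewrite /t /B /= scale_row_mx row_mxKl !mxE mulrCA [_^-1 * _]mulrC.
have rB y : rsubmx (B y) = (2 / (dotp y y + 1)) *: y.
  by rewrite /B /= scale_row_mx row_mxKr scalerA mulrC.
split.
- split=> //=.
  + exact: openT.
  + move=> p; rewrite /sphere /= expr1n normE -/(t p) => p1 pN; split=> //.
    have K0 : 1 - s * t p != 0 by rewrite gt_eqF // subr_gt0.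
    set r := rsubmx p in p1 *; set K := 1 - s * t p in K0 *.
    have rr : dotp r r = 1 - t p ^+ 2 by rewrite -p1 [t p ^+ 2 + _]addrC addrK.
    have qE : dotp (K^-1 *: r) (K^-1 *: r) = (1 + s * t p) / K.
      have -> : 1 + s * t p = dotp r r / K.
        by apply: (mulIf K0); rewrite mulfVK // rr /K; ring: ss.
      by rewrite dotpZl dotpZr; field.
    rewrite qE.
    have -> : ((1 + s * t p) / K + 1)^-1 = K / 2.
      have -> : (1 + s * t p) / K + 1 = 2 / K by rewrite /K; field.
      by rewrite invf_div.
    rewrite scale_row_mx !scalerA -[RHS]hsubmxK; congr row_mx.
      apply/rowP => i; rewrite (ord1 i) !mxE -[RHS]/(p 0 _).
      have -> : K / 2 * (s * ((1 + s * t p) / K - 1)) = (s * s) * t p.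
        by rewrite /K; field.
      by rewrite ss mul1r /t mxE.
    by rewrite (_ : K / 2 * 2 / K = 1) ?scale1r //; field.
  + move=> y _; rewrite -/(t _) tB rB; set q := dotp y y.
    have q1 : q + 1 != 0 by rewrite gt_eqF // q0.
    have E : s * (s * ((q - 1) / (q + 1))) = (q - 1) / (q + 1) by rewrite mulrA ss mul1r.
    rewrite E; split.
    * rewrite /sphere /= expr1n normE tB rB dotpZl dotpZr -/q.
      have -> : (s * ((q - 1) / (q + 1))) ^+ 2 = (s * s) * ((q - 1) / (q + 1)) ^+ 2.
        by rewrite exprMn expr2.
      by rewrite ss; field.
    * by rewrite ltr_pdivrMr ?q0 // mul1r ltrD2l -subr_gt0 opprK addr_gt0.
    * have -> : 1 - (q - 1) / (q + 1) = 2 / (q + 1) by field.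
      by rewrite scalerA mulVf ?scale1r // mulf_neq0 ?invr_eq0.
- apply: Cinf_smooth_on => k; apply: Ck_scale => //=; last exact: Cinf_linear oN k.
  by apply: Ck_inv => // [y|]; [rewrite /= subr_gt0|exact: sK].
- apply: Cinf_smooth_on => k /=.
  have sq : Ck k setT (fun y : 'rV[R]_n => dotp y y).
    by apply: Ck_dotp; [exact: openT|exact: Ck_id openT|exact: Ck_id openT].
  have sD c : Ck k setT (fun y : 'rV[R]_n => dotp y y + c).
    by apply: Ck_add => //; [exact: openT|exact: Ck_cst].
  apply: Ck_scale; first exact: openT.
    by apply: Ck_inv => [|y _|//]; [exact: openT|exact: q0].
  apply: Ck_row_mx; first exact: openT.
    apply: Ck_rV => [|j]; first exact: openT.
    apply: (@Ck_eq _ _ _ k setT (fun y => s *: (dotp y y - 1))); first exact: openT.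
      by move=> y _; rewrite mxE.
    by apply: (@Ck_scale _ _ _ k setT (fun=> s)); [exact: openT|exact: Ck_cst|].
  by apply: (@Ck_scale _ _ _ k setT (fun=> 2));
    [exact: openT|exact: Ck_cst|exact: Ck_id openT].
Qed.

Lemma embedded_sphere {n d} : d = n.+1 ->
  embedded_submanifold n (sphere 1 : set 'rV[R]_d).
Proof.
move=> ->; rewrite -[n.+1]/(1 + n)%N => p _.
have [p1|p1] := ltP (lsubmx p 0 0) 1.
  by exists (stereographic 1); [apply: embedded_stereographic; rewrite mul1r|rewrite /= mul1r].
exists (stereographic (-1)); first by apply: embedded_stereographic; rewrite mulrNN mul1r.
by rewrite /= mulN1r -subr_gt0 opprK addr_gt0 // (lt_le_trans _ p1).
Qed.

Definition product_chart {d1 d2 n1 n2} (c1 : chart R 'rV[R]_d1 n1)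
    (c2 : chart R 'rV[R]_d2 n2) : chart R 'rV[R]_(d1 + d2) (n1 + n2) :=
  Chart [set p | cnbhd c1 (lsubmx p) /\ cnbhd c2 (rsubmx p)]
    [set x | ccod c1 (lsubmx x) /\ ccod c2 (rsubmx x)]
    (fun p => row_mx (cfwd c1 (lsubmx p)) (cfwd c2 (rsubmx p)))
    (fun x => row_mx (cbwd c1 (lsubmx x)) (cbwd c2 (rsubmx x))).

Lemma open_split {d1 d2} (A : set 'rV[R]_d1) (B : set 'rV[R]_d2) :
  open A -> open B ->
  open [set p : 'rV[R]_(d1 + d2) | A (lsubmx p) /\ B (rsubmx p)].
Proof.
move=> oA oB.
rewrite (_ : mkset _ = (@lsubmx _ 1 d1 d2) @^-1` A `&` (@rsubmx _ 1 d1 d2) @^-1` B) //.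
by apply: openI; apply: open_comp => // x _;
  [exact: continuous_lsubmx|exact: continuous_rsubmx].
Qed.

Lemma Cinf_split {d1 d2 n1 n2} (A : set 'rV[R]_d1) (B : set 'rV[R]_d2)
    (f1 : 'rV[R]_d1 -> 'rV[R]_n1) (f2 : 'rV[R]_d2 -> 'rV[R]_n2) :
  open A -> open B -> Cinf A f1 -> Cinf B f2 ->
  Cinf [set p : 'rV[R]_(d1 + d2) | A (lsubmx p) /\ B (rsubmx p)]
    (fun p => row_mx (f1 (lsubmx p)) (f2 (rsubmx p))).
Proof.
move=> oA oB s1 s2 k; have oU := open_split oA oB; apply: Ck_row_mx => //.
  apply: (@Ck_comp _ _ _ _ k _ A (fun p => lsubmx p) f1 oU) => //; first by move=> p [].
  exact: Cinf_linear oU k.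
apply: (@Ck_comp _ _ _ _ k _ B (fun p => rsubmx p) f2 oU) => //; first by move=> p [].
exact: Cinf_linear oU k.
Qed.

Lemma embedded_product_chart {d1 d2 n1 n2} (M1 : set 'rV[R]_d1)
    (M2 : set 'rV[R]_d2) (c1 : chart R 'rV[R]_d1 n1) (c2 : chart R 'rV[R]_d2 n2) :
  embedded_chart M1 c1 -> embedded_chart M2 c2 ->
  embedded_chart (product_submanifold M1 M2) (product_chart c1 c2).
Proof.
move=> e1 e2.
have [oV1 oO1 sB1 sF1 _] := embedded_chart_parametrization e1.
have [oV2 oO2 sB2 sF2 _] := embedded_chart_parametrization e2.
case: e1 => [[_ _ F1 B1] _ _]; case: e2 => [[_ _ F2 B2] _ _].
split; last 2 first.
- by apply: Cinf_smooth_on; exact: Cinf_split.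
- by apply: Cinf_smooth_on; exact: Cinf_split.
split=> /=; [exact: open_split|exact: open_split| |].
  move=> _ [[p1 p2] [/= Mp1 Mp2] <-]; rewrite !row_mxKl !row_mxKr => -[N1 N2].
  have [C1 ->] := F1 _ Mp1 N1; have [C2 ->] := F2 _ Mp2 N2.
  by [].
move=> x [C1 C2]; rewrite !row_mxKl !row_mxKr.
have [M1x N1 ->] := B1 _ C1; have [M2x N2 ->] := B2 _ C2.
split=> //; last exact: hsubmxK.
by exists (cbwd c1 (lsubmx x), cbwd c2 (rsubmx x)).
Qed.

Lemma embedded_product {d1 d2 n1 n2} (M1 : set 'rV[R]_d1) (M2 : set 'rV[R]_d2) :
  embedded_submanifold n1 M1 -> embedded_submanifold n2 M2 ->
  embedded_submanifold (n1 + n2) (product_submanifold M1 M2).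
Proof.
move=> e1 e2 _ [[p1 p2] [/= /e1[c1 E1 N1] /e2[c2 E2 N2]] <-].
exists (product_chart c1 c2); first exact: embedded_product_chart.
by rewrite /= row_mxKl row_mxKr.
Qed.

End SubmanifoldCharts.

(** * Products of immersions *)

Section ProductImmersions.
Local Open Scope classical_set_scope.
Local Open Scope ring_scope.
Context {R : realType}.

Definition orthonormal_at {m d} (f : 'rV[R]_m -> 'rV[R]_d) (x : 'rV[R]_m)
    (a : 'I_m -> 'rV[R]_m) :=
  forall i j, dotp ('D_(a i) f x) ('D_(a j) f x) = (i == j)%:R.

Lemma frame_trace {m d} (U : set 'rV[R]_m) (f : 'rV[R]_m -> 'rV[R]_d) x
    {V : lmodType R} (b : 'rV[R]_m -> 'rV[R]_m -> V) (a a' : 'I_m -> 'rV[R]_m) :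
  U x -> Cinf U f -> bilin b -> orthonormal_at f x a -> orthonormal_at f x a' ->
  \sum_i b (a i) (a i) = \sum_i b (a' i) (a' i).
Proof.
move=> Ux sf bb.
have H c : orthonormal_at f x c ->
    (\matrix_i c i) *m gram f x *m (\matrix_i c i)^T = 1%:M.
  move=> oc; apply/matrixP => i j.
  rewrite [RHS]mxE -oc -(gram_form Ux sf (c i) (c j)).
  rewrite -[c i](rowK c i) -[c j](rowK c j) -row_mul tr_row.
  by rewrite [LHS]mxE [RHS]mxE; apply: eq_bigr => k _; rewrite !mxE.
move=> /H oa /H oa'; have := bilin_trace_frame bb oa oa'.
by under eq_bigr do rewrite rowK; under [X in _ = X]eq_bigr do rewrite rowK.
Qed.

(** Both parametrizations have the same tangent space, because the derivative of [q]
    is invertible, and their second derivatives differ by a tangent vector. *)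
Lemma normal_hessian_reparam {m d} (U V : set 'rV[R]_m)
    (F f : 'rV[R]_m -> 'rV[R]_d) (q : 'rV[R]_m -> 'rV[R]_m) x u v :
  open U -> U x -> open V -> (forall y, U y -> V (q y)) ->
  Cinf U q -> Cinf U f -> Cinf V F -> (forall y, U y -> f y = F (q y)) ->
  immersion_at f x -> immersion_at F (q x) ->
  normal_hessian f x u v = normal_hessian F (q x) ('D_u q x) ('D_v q x).
Proof.
move=> oU Ux oV UV sq sf sF fE imf imF.
have dq y : U y -> differentiable q y by exact: Cinf_differentiable.
have dF y : U y -> differentiable F (q y) by move=> /UV; exact: Cinf_differentiable.
have Df w y : U y -> 'D_w f y = 'D_('D_w q y) F (q y).
  move=> Uy; apply: etrans (eq_on_derive w oU Uy fE) _.
  exact: derive_comp (dq y Uy) (dF y Uy).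
have dqv : differentiable ('D_v q) x by exact: Cinf_differentiable (Cinf_derive _ sq) Ux.
pose c := christoffel_form (gram F) (q x) ('D_u q x) ('D_v q x).
pose b := 'D_u ('D_v q) x + c.
have uJ : jacobian q x \in unitmx.
  rewrite -row_free_unit -kermx_eq0; apply/rowV0P => w /sub_kermxP w0.
  apply: imf; rewrite Df //.
  by rewrite (deriveEjacobian _ (dq x Ux)) w0 derive0.
apply: (@normal_hessian_unique _ _ _ U f x oU Ux sf imf u v _ (b *m invmx (jacobian q x))).
  move=> w; rewrite (Df w x Ux).
  exact: (normal_hessian_orth oV (UV x Ux) sF imF).
have bE : 'D_(b *m invmx (jacobian q x)) q x = b.
  by rewrite (deriveEjacobian _ (dq x Ux)) mulmxKV.
have D2 : 'D_u ('D_v f) x =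
    'D_('D_u ('D_v q) x) F (q x) + 'D_('D_u q x) ('D_('D_v q x) F) (q x).
  apply: etrans (eq_on_derive u oU Ux (Df v)) _.
  exact: (derive_along u oU Ux UV oV sF dq dqv).
have R0 : 'D_(b *m invmx (jacobian q x)) f x = 'D_('D_u ('D_v q) x) F (q x) + 'D_c F (q x).
  apply: etrans (Df _ x Ux) _; rewrite bE; exact: derive_vecD (dF x Ux).
have fin (a1 a2 a3 : 'rV[R]_d) : a1 + a2 - (a2 - a3) = a1 + a3.
  by rewrite opprB addrACA subrr addr0.
exact: etrans (congr1 (fun z => z - _) D2) (etrans (fin _ _ _) (esym R0)).
Qed.

Section Product.
Context {m1 m2 d1 d2 : nat} (V1 : set 'rV[R]_m1) (V2 : set 'rV[R]_m2).

Let V := [set y : 'rV[R]_(m1 + m2) | V1 (lsubmx y) /\ V2 (rsubmx y)].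
Hypotheses (oV1 : open V1) (oV2 : open V2).

Let oV : open V. Proof. exact: open_split. Qed.

Lemma derive_row_mx {e1 e2} (f1 : 'rV[R]_m1 -> 'rV[R]_e1) (f2 : 'rV[R]_m2 -> 'rV[R]_e2) y v :
  Cinf V1 f1 -> Cinf V2 f2 -> V y ->
  'D_v (fun z : 'rV[R]_(m1 + m2) => row_mx (f1 (lsubmx z)) (f2 (rsubmx z))) y =
  row_mx ('D_(lsubmx v) f1 (lsubmx y)) ('D_(rsubmx v) f2 (rsubmx y)).
Proof.
move=> s1 s2 Vy; have dF := Cinf_differentiable (Cinf_split oV1 oV2 s1 s2) Vy.
have df1 : differentiable f1 (lsubmx y) by apply: Cinf_differentiable s1 _; case: Vy.
have df2 : differentiable f2 (rsubmx y) by apply: Cinf_differentiable s2 _; case: Vy.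
have dl : differentiable (@lsubmx R 1 m1 m2) y by exact: differentiable_lsubmx.
have dr : differentiable (@rsubmx R 1 m1 m2) y by exact: differentiable_rsubmx.
have dlE : 'D_v (@lsubmx R 1 m1 m2) y = lsubmx v.
  by rewrite (deriveE v dl) (diff_lin y (@continuous_lsubmx _ 1 m1 m2)).
have drE : 'D_v (@rsubmx R 1 m1 m2) y = rsubmx v.
  by rewrite (deriveE v dr) (diff_lin y (@continuous_rsubmx _ 1 m1 m2)).
rewrite -[LHS]hsubmxK; congr row_mx.
  have := derive_post_linear v (@continuous_lsubmx _ 1 e1 e2) dF => <-.
  under eq_fun do rewrite /= row_mxKl.
  by rewrite (derive_comp v dl df1) dlE.
have := derive_post_linear v (@continuous_rsubmx _ 1 e1 e2) dF => <-.
under eq_fun do rewrite /= row_mxKr.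
by rewrite (derive_comp v dr df2) drE.
Qed.


Context (f1 : 'rV[R]_m1 -> 'rV[R]_d1) (f2 : 'rV[R]_m2 -> 'rV[R]_d2).
Hypotheses (s1 : Cinf V1 f1) (s2 : Cinf V2 f2).

Let F (y : 'rV[R]_(m1 + m2)) := row_mx (f1 (lsubmx y)) (f2 (rsubmx y)).

Context (y : 'rV[R]_(m1 + m2)) (Vy : V y).
Hypothesis im1 : immersion_at f1 (lsubmx y).
Hypothesis im2 : immersion_at f2 (rsubmx y).

Let sF : Cinf V F. Proof. exact: Cinf_split. Qed.

Lemma immersion_product : immersion_at F y.
Proof.
move=> v; rewrite derive_row_mx // -[RHS]row_mx0 => /eq_row_mx[/im1 l0 /im2 r0].
by rewrite -[v]hsubmxK l0 r0 row_mx0.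
Qed.

(** The pair is orthogonal to the product of the two tangent spaces, and it differs
    from the second derivative by a pair of tangent vectors. *)
Lemma normal_hessian_product u v : normal_hessian F y u v =
  row_mx (normal_hessian f1 (lsubmx y) (lsubmx u) (lsubmx v))
         (normal_hessian f2 (rsubmx y) (rsubmx u) (rsubmx v)).
Proof.
pose c1 := christoffel_form (gram f1) (lsubmx y) (lsubmx u) (lsubmx v).
pose c2 := christoffel_form (gram f2) (rsubmx y) (rsubmx u) (rsubmx v).
apply: (@normal_hessian_unique _ _ _ V F y oV Vy sF immersion_product u v _ (row_mx c1 c2)).
  move=> w; have -> := @derive_row_mx _ _ f1 f2 y w s1 s2 Vy; rewrite dotp_row_mx.
  have -> := @normal_hessian_orth _ _ _ V1 f1 _ oV1 Vy.1 s1 im1 (lsubmx u) (lsubmx v) (lsubmx w).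
  have -> := @normal_hessian_orth _ _ _ V2 f2 _ oV2 Vy.2 s2 im2 (rsubmx u) (rsubmx v) (rsubmx w).
  by rewrite addr0.
have D2 : 'D_u ('D_v F) y = row_mx ('D_(lsubmx u) ('D_(lsubmx v) f1) (lsubmx y))
    ('D_(rsubmx u) ('D_(rsubmx v) f2) (rsubmx y)).
  apply: etrans (eq_on_derive u oV Vy (fun z Vz => derive_row_mx v s1 s2 Vz)) _.
  exact: (derive_row_mx u (Cinf_derive _ s1) (Cinf_derive _ s2) Vy).
apply: etrans (congr1 (fun z => z - _) D2) _.
rewrite opp_row_mx add_row_mx.
have -> := @derive_row_mx _ _ f1 f2 y (row_mx c1 c2) s1 s2 Vy.
rewrite row_mxKl row_mxKr.
have fin (k : nat) (a b : 'rV[R]_k) : a - (a - b) = b by rewrite opprB addrCA subrr addr0.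
by congr row_mx; exact: fin.
Qed.

Context (E1 : 'I_m1 -> 'rV[R]_m1) (E2 : 'I_m2 -> 'rV[R]_m2).
Hypothesis oE1 : orthonormal_at f1 (lsubmx y) E1.
Hypothesis oE2 : orthonormal_at f2 (rsubmx y) E2.

Definition product_frame (i : 'I_(m1 + m2)) : 'rV[R]_(m1 + m2) :=
  match fintype.split i with
  | inl k => row_mx (E1 k) 0
  | inr k => row_mx 0 (E2 k)
  end.

Lemma product_framel k : product_frame (lshift m2 k) = row_mx (E1 k) 0.
Proof. by rewrite /product_frame (unsplitK (inl k)). Qed.

Lemma product_framer k : product_frame (rshift m1 k) = row_mx 0 (E2 k).
Proof. by rewrite /product_frame (unsplitK (inr k)). Qed.

Lemma derive_product_framel k :
  'D_(product_frame (lshift m2 k)) F y = row_mx ('D_(E1 k) f1 (lsubmx y)) 0.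
Proof.
rewrite product_framel; apply: etrans (derive_row_mx _ s1 s2 Vy) _.
by rewrite row_mxKl row_mxKr derive0.
Qed.

Lemma derive_product_framer k :
  'D_(product_frame (rshift m1 k)) F y = row_mx 0 ('D_(E2 k) f2 (rsubmx y)).
Proof.
rewrite product_framer; apply: etrans (derive_row_mx _ s1 s2 Vy) _.
by rewrite row_mxKl row_mxKr derive0.
Qed.

Lemma orthonormal_product_frame : orthonormal_at F y product_frame.
Proof.
have r0 k (a : 'rV[R]_k) : dotp a 0 = 0 by rewrite dotpC dotp0l.
move=> i j; case: (split_ordP i) => k ->; case: (split_ordP j) => l ->.
- by rewrite !derive_product_framel dotp_row_mx oE1 r0 addr0 eq_lshift.
- rewrite derive_product_framel derive_product_framer dotp_row_mx dotp0l r0 addr0.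
  by rewrite eq_lrshift.
- rewrite derive_product_framel derive_product_framer dotp_row_mx dotp0l r0 addr0.
  by rewrite eq_rlshift.
- by rewrite !derive_product_framer dotp_row_mx oE2 r0 add0r eq_rshift.
Qed.

(** Computed in the frame made of frames of the two factors. *)
Lemma trace_normal_hessian_product (a : 'I_(m1 + m2) -> 'rV[R]_(m1 + m2)) :
  orthonormal_at F y a ->
  \sum_i normal_hessian F y (a i) (a i) =
  row_mx (\sum_i normal_hessian f1 (lsubmx y) (E1 i) (E1 i))
         (\sum_i normal_hessian f2 (rsubmx y) (E2 i) (E2 i)).
Proof.
move=> oa; have bF := bilin_normal_hessian oV Vy sF.
rewrite (frame_trace Vy sF bF oa orthonormal_product_frame) big_split_ord /=.
have b1 := bilin_normal_hessian oV1 Vy.1 s1.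
have b2 := bilin_normal_hessian oV2 Vy.2 s2.
have -> : \sum_i normal_hessian F y (product_frame (lshift m2 i))
      (product_frame (lshift m2 i)) =
    row_mx (\sum_i normal_hessian f1 (lsubmx y) (E1 i) (E1 i)) 0.
  have -> : row_mx (\sum_i normal_hessian f1 (lsubmx y) (E1 i) (E1 i)) 0 =
      \sum_i row_mx (normal_hessian f1 (lsubmx y) (E1 i) (E1 i)) (0 : 'rV[R]_d2).
    by apply: (big_morph (fun z => row_mx z 0)) => [p q|];
      rewrite ?row_mx0 // add_row_mx addr0.
  apply: eq_bigr => i _; rewrite product_framel normal_hessian_product.
  by rewrite row_mxKl row_mxKr (bilin0l b2).
have -> : \sum_i normal_hessian F y (product_frame (rshift m1 i))
      (product_frame (rshift m1 i)) =
    row_mx 0 (\sum_i normal_hessian f2 (rsubmx y) (E2 i) (E2 i)).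
  have -> : row_mx 0 (\sum_i normal_hessian f2 (rsubmx y) (E2 i) (E2 i)) =
      \sum_i row_mx (0 : 'rV[R]_d1) (normal_hessian f2 (rsubmx y) (E2 i) (E2 i)).
    by apply: (big_morph (fun z => row_mx 0 z)) => [p q|];
      rewrite ?row_mx0 // add_row_mx addr0.
  apply: eq_bigr => i _; rewrite product_framer normal_hessian_product.
  by rewrite row_mxKl row_mxKr (bilin0l b1).
by rewrite add_row_mx addr0 add0r.
Qed.

(** The left-hand side is the trace, over the tangent space, of the reflection that is
    1 on the first factor and -1 on the second; frames of the two factors are
    eigenvectors. *)
Lemma trace_reflection_product (a : 'I_(m1 + m2) -> 'rV[R]_(m1 + m2)) :
  orthonormal_at F y a ->
  \sum_i (dotp (lsubmx ('D_(a i) F y)) (lsubmx ('D_(a i) F y))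
          - dotp (rsubmx ('D_(a i) F y)) (rsubmx ('D_(a i) F y))) =
  m1%:R - m2%:R.
Proof.
move=> oa; have dF := Cinf_differentiable sF Vy.
pose b0 (p q : 'rV[R]_(d1 + d2)) : R^o :=
  dotp (lsubmx p) (lsubmx q) - dotp (rsubmx p) (rsubmx q).
have b0C p q : b0 p q = b0 q p.
  by rewrite /b0 [dotp (lsubmx p) _]dotpC [dotp (rsubmx p) _]dotpC.
have b0l c p q r : b0 (c *: p + q) r = c *: b0 p r + b0 q r.
  by rewrite /b0 !linearP /= !dotpPl scalerBr opprD addrACA.
pose b u v := b0 ('D_u F y) ('D_v F y).
have bC u v : b u v = b v u by exact: b0C.
have bl c u v w : b (c *: u + v) w = c *: b u w + b v w.
  by rewrite /b (derive_linear c u v dF); exact: b0l.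
have bb : bilin b.
  split=> c u v w; first exact: bl.
  exact: etrans (bC _ _) (etrans (bl c u v w) (congr2 (fun p q => c *: p + q) (bC _ _) (bC _ _))).
apply: etrans (frame_trace Vy sF bb oa orthonormal_product_frame) _.
rewrite big_split_ord /=; congr (_ + _).
  rewrite -[RHS]mulr1 -[m1 in RHS]card_ord -sumr_const mulr_suml; apply: eq_bigr => i _.
  by rewrite /b derive_product_framel /b0 row_mxKl row_mxKr oE1 eqxx dotp0l subr0 mulr1.
rewrite -[RHS]mulr1 -[m2 in RHS]card_ord -sumr_const mulNr mulr_suml -sumrN.
apply: eq_bigr => i _.
by rewrite /b derive_product_framer /b0 row_mxKl row_mxKr oE2 eqxx dotp0l sub0r mulr1.
Qed.

End Product.
End ProductImmersions.

(** * Minimal submanifolds of spheres and their products *)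

Section Inclusions.
Local Open Scope classical_set_scope.
Local Open Scope ring_scope.
Context {R : realType}.

Lemma open_preimage_on {n d} (U : set 'rV[R]_n) (O : set 'rV[R]_d)
    (f : 'rV[R]_n -> 'rV[R]_d) : open U -> open O ->
  (forall x, U x -> differentiable f x) -> open [set x | U x /\ O (f x)].
Proof.
move=> oU oO df; rewrite openE => x [Ux Ofx]; apply: filterI.
  exact: (near_open oU Ux).
have cf := differentiable_continuous (df x Ux).
exact: cf (near_open oO Ofx).
Qed.

Lemma orthonormal_frameP {d m} (M : set 'rV[R]_d) (c : chart R 'rV[R]_d m)
    (W : set 'rV[R]_m) (e : 'I_m -> 'rV[R]_m -> 'rV[R]_m) :
  embedded_chart M c -> open W -> W `<=` ccod c ->
  orthonormal_frame (induced_metric c) W e <->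
  (forall i, Cinf W (e i)) /\
  (forall y, W y -> orthonormal_at (cbwd c) y (fun i => e i y)).
Proof.
move=> /embedded_chart_parametrization[oV _ sf _ _] oW WV.
have G y i j : W y -> (e i y *m induced_metric c y *m (e j y)^T) 0 0 =
    dotp ('D_(e i y) (cbwd c) y) ('D_(e j y) (cbwd c) y).
  by move=> /WV Vy; exact: gram_form Vy sf _ _.
split=> -[se oe]; split.
- by move=> i; apply: smooth_on_Cinf.
- by move=> y Wy i j; rewrite -G // oe.
- by move=> i; apply: Cinf_smooth_on.
- by move=> y Wy i j; rewrite G // oe.
Qed.

(** Around every point there are coordinates and a frame to which the definitions of
    harmonic and biharmonic inclusions apply. *)
Lemma exists_adapted_frame {d m n} (M N : set 'rV[R]_d) p :
  @embedded_submanifold R d m M -> @embedded_submanifold R d n N -> M `<=` N -> M p ->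
  exists (c : chart R 'rV[R]_d m) (c' : chart R 'rV[R]_d n) W e,
    [/\ embedded_chart M c /\ embedded_chart N c',
        open W, W `<=` [set x | ccod c x /\ cnbhd c' (cbwd c x)],
        orthonormal_frame (induced_metric c) W e
      & [/\ cnbhd c p, W (cfwd c p) & cbwd c (cfwd c p) = p]].
Proof.
move=> eM eN MN Mp; have [c ec cp] := eM p Mp; have [c' ec' c'p] := eN p (MN p Mp).
have par := embedded_chart_parametrization ec.
have [oV oO sf _ _] := par.
have [oO' _] : open (cnbhd c') /\ True by case: ec' => [[]].
have Cp : ccod c (cfwd c p) /\ cbwd c (cfwd c p) = p.
  by case: ec => [[_ _ H _] _ _]; exact: H.
pose W := [set x | ccod c x /\ cnbhd c' (cbwd c x)].
have oW : open W by apply: open_preimage_on => // x Vx; exact: (param_diff par Vx).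
have WV : W `<=` ccod c by move=> x [].
have sfW : Cinf W (cbwd c) by move=> k; exact: Ck_subset WV (sf k).
have [e [se oe]] := exists_orthonormal_frame oW sfW
  (fun y Wy => param_immersion par (WV y Wy)).
exists c, c', W, e; split=> //; first by apply/(orthonormal_frameP e ec oW WV).
by split=> //; [split; [exact: Cp.1|rewrite Cp.2]|exact: Cp.2].
Qed.

Section TensionOfInclusion.
Context {d m n : nat} (M : set 'rV[R]_d) (r : R).
Hypotheses (r0 : r != 0) (dim : d = n.+1) (MN : M `<=` sphere r).
Context (c : chart R 'rV[R]_d m) (c' : chart R 'rV[R]_d n).
Hypotheses (ec : embedded_chart M c) (ec' : embedded_chart (sphere r) c').
Context (W : set 'rV[R]_m) (e : 'I_m -> 'rV[R]_m -> 'rV[R]_m).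
Hypotheses (oW : open W).
Hypothesis WV : W `<=` [set x | ccod c x /\ cnbhd c' (cbwd c x)].
Hypothesis fe : orthonormal_frame (induced_metric c) W e.

Let phi := cfwd c' \o cbwd c.

Lemma chart_in x : ccod c x -> M (cbwd c x).
Proof. by case: ec => [[_ _ _ H] _ _] /H[]. Qed.

Lemma chart_smooth : Cinf W (cbwd c).
Proof.
have [_ _ sf _ _] := embedded_chart_parametrization ec.
by move=> k; apply: Ck_subset (sf k) => x /WV[].
Qed.

Lemma inclusion_smooth : Cinf W phi.
Proof.
have [_ oO _ srho _] := embedded_chart_parametrization ec'.
move=> k; apply: (Ck_comp oW _ (chart_smooth k) (srho k)).
by move=> x /WV[].
Qed.

Lemma inclusion_chart y : W y -> ccod c' (phi y) /\ cbwd c' (phi y) = cbwd c y.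
Proof.
move=> /WV[Vy Oy]; case: ec' => [[_ _ H _] _ _].
by apply: H => //; apply: MN; exact: chart_in.
Qed.

Lemma sphere_chart_norm y : ccod c' y -> dotp (cbwd c' y) (cbwd c' y) = r ^+ 2.
Proof. by case: ec' => [[_ _ _ H] _ _] /H[]. Qed.

Let WV' : W `<=` ccod c. Proof. by move=> x /WV[]. Qed.

Lemma frame_smooth i : Cinf W (e i).
Proof. by have [se _] := (orthonormal_frameP e ec oW WV').1 fe. Qed.

Lemma frame_orthonormal y : W y -> orthonormal_at (cbwd c) y (fun i => e i y).
Proof. by have [_] := (orthonormal_frameP e ec oW WV').1 fe; apply. Qed.

Lemma inclusion_tension x : W x ->
  'D_(tension_field (induced_metric c) (induced_metric c') phi e x) (cbwd c') (phi x) =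
  \sum_i normal_hessian (cbwd c) x (e i x) (e i x) + (m%:R * (r ^+ 2)^-1) *: cbwd c x.
Proof.
have r20 : r ^+ 2 != 0 by rewrite expf_neq0.
exact: (push_tension (embedded_chart_parametrization ec') sphere_chart_norm r20 dim
  oW chart_smooth inclusion_smooth (fun y Wy => (inclusion_chart Wy).1)
  (fun y Wy => (inclusion_chart Wy).2) frame_smooth frame_orthonormal).
Qed.

End TensionOfInclusion.

(** Vanishing tension in the sphere means that the Euclidean mean curvature vector
    points to the centre. *)
Lemma minimal_trace {d m n} (M : set 'rV[R]_d) (r : R) p : r != 0 -> d = n.+1 ->
  minimal_submanifold m n M (sphere r) -> M p ->
  exists (c : chart R 'rV[R]_d m) (E : 'I_m -> 'rV[R]_m),
    [/\ embedded_chart M c, cnbhd c p, orthonormal_at (cbwd c) (cfwd c p) E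
      & \sum_i normal_hessian (cbwd c) (cfwd c p) (E i) (E i)
        = - (m%:R * (r ^+ 2)^-1) *: p].
Proof.
move=> r0 dim [[eM eN MN] harm] Mp.
have [c [c' [W [e [[ec ec'] oW WV fe [cp Wp pE]]]]]] := exists_adapted_frame eM eN MN Mp.
have T0 := harm c c' ec ec' W e oW WV fe _ Wp.
have := inclusion_tension r0 dim MN ec ec' oW WV fe Wp.
rewrite T0 derive0 pE => /esym/eqP; rewrite addr_eq0 -scaleNr => /eqP tr.
exists c, (fun i => e i (cfwd c p)); split=> //.
exact (frame_orthonormal ec oW WV fe Wp).
Qed.


Section ProductOfMinimal.
Context {d1 d2 k1 k2 m1 m2 : nat}.
Context (M1 : set 'rV[R]_d1) (M2 : set 'rV[R]_d2) (r1 r2 : R).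
Hypotheses (r1_neq0 : r1 != 0) (r2_neq0 : r2 != 0).
Hypotheses (dim1 : d1 = k1.+1) (dim2 : d2 = k2.+1).
Hypotheses (min1 : minimal_submanifold m1 k1 M1 (sphere r1)).
Hypotheses (min2 : minimal_submanifold m2 k2 M2 (sphere r2)).
Context (c : chart R 'rV[R]_(d1 + d2) (m1 + m2)).
Hypothesis ec : embedded_chart (product_submanifold M1 M2) c.
Context (x : 'rV[R]_(m1 + m2)) (Cx : ccod c x).
Context (a : 'I_(m1 + m2) -> 'rV[R]_(m1 + m2)).
Hypothesis oa : orthonormal_at (cbwd c) x a.

(** The given chart is compared with the product of charts in which the minimality of
    the factors is known; both traces are independent of charts and frames. *)
Lemma product_chart_traces :
  \sum_i normal_hessian (cbwd c) x (a i) (a i) =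
    row_mx (- (m1%:R * (r1 ^+ 2)^-1) *: lsubmx (cbwd c x))
           (- (m2%:R * (r2 ^+ 2)^-1) *: rsubmx (cbwd c x)) /\
  \sum_i (dotp (lsubmx ('D_(a i) (cbwd c) x)) (lsubmx ('D_(a i) (cbwd c) x))
          - dotp (rsubmx ('D_(a i) (cbwd c) x)) (rsubmx ('D_(a i) (cbwd c) x))) =
    m1%:R - m2%:R.
Proof.
have par := embedded_chart_parametrization ec.
have [oV oO sf _ _] := par.
have [[p1 p2] [/= Mp1 Mp2] pE] := chart_in ec Cx.
have [c1 [E1 [ec1 N1 oE1 tr1]]] := minimal_trace r1_neq0 dim1 min1 Mp1.
have [c2 [E2 [ec2 N2 oE2 tr2]]] := minimal_trace r2_neq0 dim2 min2 Mp2.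
have par1 := embedded_chart_parametrization ec1.
have par2 := embedded_chart_parametrization ec2.
have [oV1 oO1 s1 _ _] := par1; have [oV2 oO2 s2 _ _] := par2.
pose c0 := product_chart c1 c2; have ec0 := embedded_product_chart ec1 ec2.
have par0 := embedded_chart_parametrization ec0.
have [oV0 oO0 s0 srho0 _] := par0.
pose U := [set y | ccod c y /\ cnbhd c0 (cbwd c y)].
have oU : open U by apply: open_preimage_on => // y Vy; exact: (param_diff par Vy).
have Ux : U x by split=> //; rewrite -pE /= row_mxKl row_mxKr.
pose q := cfwd c0 \o cbwd c.
have UC y : U y -> ccod c y by case.
have qK y : U y -> ccod c0 (q y) /\ cbwd c0 (q y) = cbwd c y.
  move=> [Vy Oy]; case: ec0 => [[_ _ H _] _ _]; apply: H => //.
  exact: chart_in.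
have sfU : Cinf U (cbwd c) by move=> k; exact: Ck_subset UC (sf k).
have sq : Cinf U q.
  by move=> k; apply: (Ck_comp oU _ (sfU k) (srho0 k)) => y [].
have fE y : U y -> cbwd c y = cbwd c0 (q y) by move=> /qK[].
have V0x := (qK x Ux).1.
have imf := param_immersion par Cx; have im0 := param_immersion par0 V0x.
have ql : lsubmx (q x) = cfwd c1 p1 by rewrite /q /= -pE !row_mxKl.
have qr : rsubmx (q x) = cfwd c2 p2 by rewrite /q /= -pE !row_mxKr.
have im1 := param_immersion par1 V0x.1; have im2 := param_immersion par2 V0x.2.
rewrite -ql in oE1 tr1; rewrite -qr in oE2 tr2.
have Df w : 'D_w (cbwd c) x = 'D_('D_w q x) (cbwd c0) (q x).
  apply: etrans (eq_on_derive w oU Ux fE) _.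
  exact: derive_comp (Cinf_differentiable sq Ux) (param_diff par0 V0x).
have oq : orthonormal_at (cbwd c0) (q x) (fun i => 'D_(a i) q x).
  by move=> i j; have := oa i j; rewrite (Df (a i)) (Df (a j)).
split.
  transitivity (\sum_i normal_hessian (cbwd c0) (q x) ('D_(a i) q x) ('D_(a i) q x)).
    apply: eq_bigr => i _.
    exact: (normal_hessian_reparam _ _ oU Ux oV0 (fun y Uy => (qK y Uy).1) sq sfU s0 fE imf im0).
  apply: etrans (trace_normal_hessian_product oV1 oV2 s1 s2 V0x im1 im2 oE1 oE2 oq) _.
  by rewrite tr1 tr2 -pE row_mxKl row_mxKr.
rewrite -(trace_reflection_product oV1 oV2 s1 s2 V0x oE1 oE2 oq).
by apply: eq_bigr => i _; rewrite Df.
Qed.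

End ProductOfMinimal.
End Inclusions.

Section BiharmonicProducts.
Local Open Scope classical_set_scope.
Local Open Scope ring_scope.
Context {R : realType}.

(** The orbit contains the vector [H] itself. *)
Lemma R_space_nonempty {n} (r : R) (M : set 'rV[R]_n.+1) : R_space r M -> exists p, M p.
Proof.
move=> [G [sigma [K [ip [iota [H [sym [_ rg _] mH _ ->]]]]]]].
have [u _ uH] : range iota H by rewrite rg.
exists u; exists 1%g; first by case: (sd_subgroup sym).
have c1 : (fun x : G => (1 * x * 1^-1)%g) = id.
  by apply/funext => x; rewrite mul1g invg1 mulg1.
have c2 : (fun x : G => (1^-1 * x * 1)%g) = id.
  by apply/funext => x; rewrite invg1 mul1g mulg1.
by rewrite uH /Ad c1 c2.
Qed.

(** The reflection of the ambient space that fixes the first factor; scaled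
    by [k], it turns the position vector into [k] times the unit normal of the
    product of the two spheres. *)
Definition reflection {d1 d2} (k : R) (v : 'rV[R]_(d1 + d2)) : 'rV[R]_(d1 + d2) :=
  k *: row_mx (lsubmx v) (- rsubmx v).

Lemma reflection_is_linear {d1 d2} k : linear (@reflection d1 d2 k).
Proof.
move=> b u v; rewrite /reflection !linearP /= -add_row_mx.
by rewrite -scale_row_mx scalerDr !scalerA mulrC.
Qed.

HB.instance Definition _ d1 d2 k := GRing.isLinear.Build R _ _ _ (@reflection d1 d2 k)
  (reflection_is_linear k).

Lemma dotp_reflection {d1 d2} k (u v : 'rV[R]_(d1 + d2)) :
  dotp u (reflection k v) =
  k * (dotp (lsubmx u) (lsubmx v) - dotp (rsubmx u) (rsubmx v)).
Proof.
by rewrite /reflection dotpZr -{1}[u]hsubmxK dotp_row_mx dotpNr.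
Qed.

Section CliffordProduct.
Context {d1 d2 k1 k2 m1 m2 n : nat}.
Hypotheses (dim1 : d1 = k1.+1) (dim2 : d2 = k2.+1) (dim : (d1 + d2)%N = n.+1).
Context (M1 : set 'rV[R]_d1) (M2 : set 'rV[R]_d2) (r : R).
Hypothesis r2E : r ^+ 2 = 2^-1.
Hypotheses (min1 : minimal_submanifold m1 k1 M1 (sphere r)).
Hypotheses (min2 : minimal_submanifold m2 k2 M2 (sphere r)).

Let M := product_submanifold M1 M2.

Let r_neq0 : r != 0.
Proof. by rewrite -sqrf_eq0 r2E invr_eq0 pnatr_eq0. Qed.

Lemma product_halves p : M p -> dotp (lsubmx p) (lsubmx p) = 2^-1 /\
  dotp (rsubmx p) (rsubmx p) = 2^-1.
Proof.
case: min1 min2 => [[_ _ S1] _] [[_ _ S2] _] [[p1 p2] [/= /S1 E1 /S2 E2] <-].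
by rewrite row_mxKl row_mxKr -r2E.
Qed.

Lemma product_in_sphere : M `<=` sphere 1.
Proof.
move=> p /product_halves[E1 E2].
by rewrite /sphere /= -[p]hsubmxK dotp_row_mx E1 E2; field.
Qed.

Lemma product_submanifold_of_sphere : submanifold_of (m1 + m2) n M (sphere 1).
Proof.
split; [|exact: embedded_sphere dim|exact: product_in_sphere].
by case: min1 min2 => [[? _ _] _] [[? _ _] _]; exact: embedded_product.
Qed.

Section Charts.
Context (c : chart R 'rV[R]_(d1 + d2) (m1 + m2)) (c' : chart R 'rV[R]_(d1 + d2) n).
Hypotheses (ec : embedded_chart M c) (ec' : embedded_chart (sphere 1) c').
Context (W : set 'rV[R]_(m1 + m2)) (e : 'I_(m1 + m2) -> 'rV[R]_(m1 + m2) -> 'rV[R]_(m1 + m2)).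
Hypotheses (oW : open W).
Hypothesis WV : W `<=` [set x | ccod c x /\ cnbhd c' (cbwd c x)].
Hypothesis fe : orthonormal_frame (induced_metric c) W e.

Let phi := cfwd c' \o cbwd c.
Let T := tension_field (induced_metric c) (induced_metric c') phi e.

Let traces x (Wx : W x) := product_chart_traces r_neq0 r_neq0 dim1 dim2 min1 min2
  ec (WV Wx).1 (frame_orthonormal ec oW WV fe Wx).

Lemma clifford_tension x : W x ->
  'D_(T x) (cbwd c') (phi x) = reflection (m2%:R - m1%:R) (cbwd c x).
Proof.
move=> Wx; apply: etrans (inclusion_tension (oner_neq0 R) dim product_in_sphere
  ec ec' oW WV fe Wx) _.
rewrite (traces Wx).1 expr1n invr1 mulr1 r2E invrK /reflection.
rewrite -{3}[cbwd c x]hsubmxK !scale_row_mx add_row_mx -!scalerDl scalerN -scaleNr.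
by congr (row_mx (_ *: _) (_ *: _)); rewrite natrD; ring.
Qed.

(** Both components of the position vector have constant length, so each is orthogonal
    to its derivatives. *)
Lemma clifford_normal y v : W y ->
  dotp ('D_v (cbwd c) y) (reflection (m2%:R - m1%:R) (cbwd c y)) = 0.
Proof.
move=> Wy; have df := Cinf_differentiable (chart_smooth ec WV) Wy.
have half k (L : {linear 'rV[R]_(d1 + d2) -> 'rV[R]_k}) :
    (forall z, W z -> dotp (L (cbwd c z)) (L (cbwd c z)) = 2^-1) ->
    dotp (L ('D_v (cbwd c) y)) (L (cbwd c y)) = 0.
  move=> HL; have cL := @linear_rV_continuous _ _ _ L.
  have dLf : differentiable (fun z => L (cbwd c z)) y.
    by apply: (@differentiable_comp _ _ _ _ (cbwd c) L) => //; exact: linear_differentiable.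
  have := derive_dotp v dLf dLf.
  rewrite (eq_on_derive v oW Wy HL) derive_cst (derive_post_linear v cL df).
  rewrite [dotp (L (cbwd c y)) _]dotpC => /esym/eqP.
  by rewrite -mulr2n mulrn_eq0 /= => /eqP.
have inM z : W z -> M (cbwd c z) by move=> /WV[Vz _]; exact (chart_in ec Vz).
rewrite dotp_reflection.
have -> : dotp (lsubmx ('D_v (cbwd c) y)) (lsubmx (cbwd c y)) = 0.
  by apply: half => z /inM/product_halves[].
have -> : dotp (rsubmx ('D_v (cbwd c) y)) (rsubmx (cbwd c y)) = 0.
  by apply: half => z /inM/product_halves[].
by rewrite subrr mulr0.
Qed.

Lemma clifford_biharmonic x : W x ->
  jacobi_operator (induced_metric c) (induced_metric c') phi e T x = 0.
Proof.
move=> Wx.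
have one2 : (1 : R) ^+ 2 != 0 by rewrite expr1n oner_neq0.
apply: (jacobi_operator_eq0 (embedded_chart_parametrization ec')
  (sphere_chart_norm ec') one2 dim oW (chart_smooth ec WV)
  (inclusion_smooth ec ec' oW WV)
  (fun y Wy => (inclusion_chart product_in_sphere ec ec' WV Wy).1)
  (fun y Wy => (inclusion_chart product_in_sphere ec ec' WV Wy).2)
  (frame_smooth ec oW WV fe) (fun y Wy => frame_orthonormal ec oW WV fe Wy)
  clifford_tension clifford_normal Wx).
have [tr1 tr2] := traces Wx.
pose k : R := m2%:R - m1%:R.
rewrite big_split /= -linear_sum tr1 -scaler_suml -/k.
have -> : \sum_i (1 ^+ 2)^-1 * dotp ('D_(e i x) (cbwd c) x)
    (reflection k ('D_(e i x) (cbwd c) x)) = k * (m1%:R - m2%:R).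
  rewrite -tr2 mulr_sumr; apply: eq_bigr => i _.
  by rewrite dotp_reflection expr1n invr1 mul1r.
rewrite expr1n invr1 mulr1 r2E invrK /= /reflection row_mxKl row_mxKr.
have := hsubmxK (cbwd c x); set l := lsubmx _; set q := rsubmx _ => <-.
rewrite !scale_row_mx add_row_mx !scalerN; congr row_mx.
  by rewrite !scalerA -scalerDl natrD; congr (_ *: _); rewrite /k; ring.
by rewrite !scalerA -scaleNr -scalerDl -scaleNr natrD; congr (_ *: _); rewrite /k; ring.
Qed.

End Charts.

Lemma clifford_product_biharmonic : biharmonic_submanifold (m1 + m2) n M (sphere 1).
Proof.
split; first exact: product_submanifold_of_sphere.
by move=> c c' ec ec' W e oW WV fe x Wx; exact (clifford_biharmonic ec ec' oW WV fe Wx).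
Qed.

Lemma clifford_product_not_harmonic p1 p2 : M1 p1 -> M2 p2 -> m1 <> m2 ->
  ~ harmonic_inclusion (m1 + m2) n M (sphere 1).
Proof.
move=> Mp1 Mp2 m12 harm; have [eM eS MS] := product_submanifold_of_sphere.
have Mp : M (row_mx p1 p2) by exists (p1, p2).
have [c [c' [W [e [[ec ec'] oW WV fe [cp Wp pE]]]]]] := exists_adapted_frame eM eS MS Mp.
have := clifford_tension ec ec' oW WV fe Wp.
rewrite (harm c c' ec ec' W e oW WV fe _ Wp) derive0 pE => /esym H.
have {}H := congr1 (fun v => dotp (lsubmx v) p1) H; move: H.
have [E1 _] := product_halves Mp; rewrite row_mxKl in E1.
rewrite /reflection row_mxKl row_mxKr scale_row_mx row_mxKl dotpZl E1 linear0 dotp0l.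
move/eqP; rewrite mulf_eq0 invr_eq0 pnatr_eq0 orbF subr_eq0 eqr_nat => /eqP.
by move=> /esym.
Qed.

End CliffordProduct.
End BiharmonicProducts.

Theorem theorem3p3 (R : realType) (n1 n2 m1 m2 : nat)
    (M1 : set 'rV[R]_n1.+1) (M2 : set 'rV[R]_n2.+1)
    (n1_gt0 : (0 < n1)%N) (n2_gt0 : (0 < n2)%N)
    (M1_min : minimal_R_space m1 (Num.sqrt 2)^-1 M1)
    (M2_min : minimal_R_space m2 (Num.sqrt 2)^-1 M2) :
  biharmonic_submanifold (m1 + m2) (n1 + n2 + 1)
    (product_submanifold M1 M2) (sphere 1)
  /\ (m1 <> m2 ->
      proper_biharmonic_submanifold (m1 + m2) (n1 + n2 + 1)
        (product_submanifold M1 M2) (sphere 1)).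
Proof.
have [[p1 Mp1] min1] := (R_space_nonempty M1_min.1, M1_min.2).
have [[p2 Mp2] min2] := (R_space_nonempty M2_min.1, M2_min.2).
have dim : (n1.+1 + n2.+1)%N = (n1 + n2 + 1).+1 by rewrite addSn addnS addn1.
have r2E : (Num.sqrt 2)^-1 ^+ 2 = 2^-1 :> R by rewrite exprVn sqr_sqrtr.
have bih := clifford_product_biharmonic erefl erefl dim r2E min1 min2.
split=> // m12; split=> //.
exact (clifford_product_not_harmonic erefl erefl dim r2E min1 min2 Mp1 Mp2 m12).
Qed.
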